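(* Let $(A,\alpha,\prec,\succ)$ be a multiplicative hom-dendriform algebra over $\mathbb{K}$. Then the collection of spaces $\mathcal{O}(n)=C^n_{\alpha,\mathrm{Dend}}(A,A)$, $n\ge 1$, with the partial compositions $\bullet_i:\mathcal{O}(m)\otimes\mathcal{O}(n)\to\mathcal{O}(m+n-1)$ ($1\le i\le m$), is an operad, and the element $\pi\in\mathcal{O}(2)$ given by $\pi([1];a,b)=a\prec b$, $\pi([2];a,b)=a\succ b$ defines a multiplication on this operad. The multiplication $\pi$ induces an associative product $\mathcal{O}(m)\otimes\mathcal{O}(n)\to\mathcal{O}(m+n)$ given by $f\cdot g=(-1)^m(\pi\bullet_2 g)\bullet_1 f$ and a degree $+1$ differential $\delta_{\alpha,\mathrm{Dend}}=\delta_\pi:\mathcal{O}(n)\to\mathcal{O}(n+1)$, $\delta_\pi(f)=\pi\bullet f-(-1)^{n-1}f\bullet\pi$. Hence (by a result of Gerstenhaber and Voronov) the cochain groups $C^*_{\alpha,\mathrm{Dend}}(A,A)$ inherit a homotopy $G$-algebra structure. As a consequence, the cohomology $H^*_{\alpha,\mathrm{Dend}}(A,A)$ of $(C^*_{\alpha,\mathrm{Dend}}(A,A),\delta_{\alpha,\mathrm{Dend}})$ carries a Gerstenhaber algebra structure.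
   Context: $\mathbb{K}$ is a field of characteristic zero; all spaces and maps are over $\mathbb{K}$. A multiplicative hom-dendriform algebra $(A,\alpha,\prec,\succ)$ is a vector space $A$ with a linear map $\alpha:A\to A$ and bilinear operations $\prec,\succ$ on $A$ such that for all $a,b,c\in A$: $(a\prec b)\prec\alpha(c)=\alpha(a)\prec(b\prec c+b\succ c)$; $(a\succ b)\prec\alpha(c)=\alpha(a)\succ(b\prec c)$; $(a\prec b+a\succ b)\succ\alpha(c)=\alpha(a)\succ(b\succ c)$; and $\alpha(a\prec b)=\alpha(a)\prec\alpha(b)$, $\alpha(a\succ b)=\alpha(a)\succ\alpha(b)$. Let $C_n=\{[1],\dots,[n]\}$ and let $\mathbb{K}[C_n]$ be the vector space with basis $C_n$. For $m,n\ge1$, $1\le i\le m$, define maps $R_0=R_0(m;1,\dots,n,\dots,1):C_{m+n-1}\to C_m$ and $R_i=R_i(m;1,\dots,n,\dots,1):C_{m+n-1}\to\mathbb{K}[C_n]$ (with $n$ in the $i$-th place) by: $R_0[r]=[r]$ if $r\le i-1$, $R_0[r]=[i]$ if $i\le r\le i+n-1$, $R_0[r]=[r-n+1]$ if $i+n\le r\le m+n-1$; and $R_i[r]=[r-(i-1)]$ if $i\le r\le i+n-1$, $R_i[r]=[1]+\cdots+[n]$ otherwise. For $n\ge1$, $C^n_{\alpha,\mathrm{Dend}}(A,A)$ is the space of linear maps $f:\mathbb{K}[C_n]\otimes A^{\otimes n}\to A$ with $\alpha(f([r];a_1,\dots,a_n))=f([r];\alpha(a_1),\dots,\alpha(a_n))$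 for all $[r]\in C_n$; and $C^0_{\alpha,\mathrm{Dend}}(A,A)=0$. For $f\in\mathcal{O}(m)$, $g\in\mathcal{O}(n)$, $1\le i\le m$, $[r]\in C_{m+n-1}$ and $a_1,\dots,a_{m+n-1}\in A$: $$(f\bullet_i g)([r];a_1,\dots,a_{m+n-1})=f\big(R_0[r];\alpha^{n-1}a_1,\dots,\alpha^{n-1}a_{i-1},g(R_i[r];a_i,\dots,a_{i+n-1}),\alpha^{n-1}a_{i+n},\dots,\alpha^{n-1}a_{m+n-1}\big).$$ Operad here means nonsymmetric operad: a collection of vector spaces $\mathcal{O}(n)$, $n\ge1$, with partial compositions $\bullet_i$ such that for $f\in\mathcal{O}(m)$, $g\in\mathcal{O}(n)$, $h\in\mathcal{O}(p)$: $(f\bullet_i g)\bullet_{i+j-1}h=f\bullet_i(g\bullet_j h)$ for $1\le i\le m$, $1\le j\le n$; $(f\bullet_i g)\bullet_{j+n-1}h=(f\bullet_j h)\bullet_i g$ for $1\le i<j\le m$; and there is $\mathrm{id}\in\mathcal{O}(1)$ with $f\bullet_i\mathrm{id}=f=\mathrm{id}\bullet_1 f$ (here $\mathrm{id}([1];a)=a$). A multiplication is an element $\pi\in\mathcal{O}(2)$ with $\pi\bullet_1\pi=\pi\bullet_2\pi$. For $f\in\mathcal{O}(m)$, $g\in\mathcal{O}(n)$: $f\bullet g=\sum_{i=1}^m(-1)^{(i-1)(n-1)}f\bullet_i g$ and $[f,g]=f\bullet g-(-1)^{(m-1)(n-1)}g\bullet f$. $H^n_{\alpha,\mathrm{Dend}}(A,A)$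 ($n\ge1$) is the $n$-th cohomology group of $(C^*_{\alpha,\mathrm{Dend}}(A,A),\delta_{\alpha,\mathrm{Dend}})$. A homotopy $G$-algebra is meant in the sense of Gerstenhaber and Voronov (''Homotopy $G$-algebras and moduli space operad''): a graded vector space with brace operations $x\{x_1,\dots,x_k\}$, an associative product of degree $0$ and a differential of degree $+1$, making it a differential graded associative algebra and a brace algebra, such that the braces distribute over the product and satisfy the prescribed homotopy relations with the product and the differential. A Gerstenhaber algebra is a graded vector space $H^*$ with an associative product satisfying $xy=(-1)^{mn}yx$ for $x\in H^m$, $y\in H^n$, and a bracket $H^m\otimes H^n\to H^{m+n-1}$ which is a graded Lie bracket when $H^n$ is placed in degree $n-1$, with $[x,yz]=[x,y]z+(-1)^{(m-1)n}y[x,z]$ for $x\in H^m$, $y\in H^n$. No unit is required.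
   Formalization: The product is taken as f·g = (-1)^{mn} (π •_2 g) •_1 f instead of (-1)^m (π •_2 g) •_1 f, since the displayed sign is not associative (A = K, α = id, a≺b = ab, a≻b = 0, f = g = h = id). *)

(* Defs.v *)
From HB Require Import structures.
From mathcomp Require Import all_boot all_order all_algebra.
From mathcomp Require Import boolp functions.
From mathcomp Require Import zify.

Set Implicit Arguments.
Unset Strict Implicit.
Unset Printing Implicit Defensive.

Import GRing.Theory.
Local Open Scope ring_scope.

(* A graded vector space is a family [V : nat -> lmodType K] of which only the
   components of positive degree matter: every space below is concentrated in
   degrees [n >= 1].  Degrees are the unshifted ones, [deg x = m] for
   [x : V m], and [m.-1] is the shifted degree [|x| = deg x - 1]. *)

Section Graded.
Variables (K : fieldType) (V : nat -> lmodType K).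

Definition homogeneous : Type := {n : nat & V n}.
Definition homog n (x : V n) : homogeneous := existT _ n x.

(* The degree-[k] component of [x : V n] seen as an element of the direct sum
   of the [V n]: [x] itself if [n = k] (up to transport), and [0] otherwise.
   Two linear combinations of homogeneous elements whose degrees are equal but
   not convertible are compared by equating all their components. *)
Definition part (k n : nat) (x : V n) : V k :=
  untag (0 : V k) (fun y : V k => y) (homog x).

Fact part_is_linear k n : linear (@part k n).
Proof.
move=> c x y; rewrite /part.
have [e|ne] := eqVneq n k; last by rewrite !untag_dflt //= scaler0 addr0.
by case: _ / e; rewrite !(untagE _ _ (erefl : tag (homog _) = n)).
Qed.

HB.instance Definition _ k n :=
  GRing.isLinear.Build K (V n) (V k) _ (@part k n) (@part_is_linear k n).

Definition bilinear_op (U W X : lmodType K) (f : U -> W -> X) : Prop :=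
  (forall y, linear (f^~ y)) /\ (forall x, linear (f x)).

End Graded.

Arguments part {K V} k {n} x.
Arguments homog {K V n} x.

Section Operad.
Variables (K : fieldType) (O : nat -> lmodType K).
(* [comp m n i f g] is the partial composition of [g] into the [i]-th input
   of [f]; it is meaningful for [1 <= i <= m] and [n >= 1]. *)
Variable comp : forall m n : nat, nat -> O m -> O n -> O (m + n).-1.

Record is_operad (id1 : O 1) : Prop := {
  operad_bilinear : forall m n i, (1 <= i <= m)%N -> (0 < n)%N ->
    bilinear_op (@comp m n i);
  operad_sequential : forall m n p i j (f : O m) (g : O n) (h : O p),
    (1 <= i <= m)%N -> (1 <= j <= n)%N -> (0 < p)%N ->
    forall k, part k (comp (i + j).-1 (comp i f g) h)
            = part k (comp i f (comp j g h));
  operad_parallel : forall m n p i j (f : O m) (g : O n) (h : O p),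
    (1 <= i)%N -> (i < j)%N -> (j <= m)%N -> (0 < n)%N -> (0 < p)%N ->
    forall k, part k (comp (j + n).-1 (comp i f g) h)
            = part k (comp i (comp j f h) g);
  operad_unit_r : forall m i (f : O m), (1 <= i <= m)%N ->
    forall k, part k (comp i f id1) = part k f;
  operad_unit_l : forall m (f : O m), (0 < m)%N ->
    forall k, part k (comp 1 id1 f) = part k f
}.

Definition is_multiplication (pi : O 2) : Prop :=
  comp 1 pi pi = comp 2 pi pi.

Definition bullet m n (f : O m) (g : O n) : O (m + n).-1 :=
  \sum_(1 <= i < m.+1) (-1) ^+ (i.-1 * n.-1) *: comp i f g.

Definition operad_bracket m n (f : O m) (g : O n) : O (m + n).-1 :=
  bullet f g - (-1) ^+ (m.-1 * n.-1) *: part (m + n).-1 (bullet g f).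

Definition operad_diff (pi : O 2) n (f : O n) : O n.+1 :=
  part n.+1 (bullet pi f) - (-1) ^+ n.-1 *: part n.+1 (bullet f pi).

Fact operad_diff_linear (pi : O 2) n :
  (forall m n i, bilinear_op (@comp m n i)) -> linear (@operad_diff pi n).
Proof.
move=> cb; have sumP (U W : lmodType K) r (e : nat -> nat) (F : nat -> U -> W) :
    (forall i, linear (F i)) ->
    linear (fun x => \sum_(i <- r) (-1) ^+ e i *: F i x).
  move=> Fl c x y; rewrite scaler_sumr -big_split; apply: eq_bigr => i _ /=.
  by rewrite Fl scalerDr !scalerA mulrC.
have bl m (h : O m) : linear (fun f : O n => bullet h f).
  by apply: (sumP _ _ _ (fun i => (i.-1 * n.-1)%N)) => i; apply: (cb _ _ _).2.
have br m (h : O m) : linear (fun f : O n => bullet f h).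
  by apply: (sumP _ _ _ (fun i => (i.-1 * m.-1)%N) (fun i f => comp i f h)) => i;
     apply: (cb _ _ _).1.
move=> c f g; rewrite /operad_diff bl br !part_is_linear scalerDr opprD addrACA.
by rewrite scalerBr !scalerA mulrC.
Qed.

(* The product [(-1)^m pi{f, g}] of Gerstenhaber and Voronov, the brace
   [pi{f, g}] being the one of [operad_brace] below.  That brace carries the
   sign [(-1)^(m (n - 1))], as [g] has the [m] inputs of [f] in front of it,
   whence the sign [(-1)^(m n)].  With [(-1)^m] in front of the bare
   composition the product would be neither associative nor compatible with
   [operad_diff]. *)
Definition operad_dot (pi : O 2) m n (f : O m) (g : O n) : O (m + n) :=
  (-1) ^+ (m * n) *: part (m + n) (comp 1 (comp 2 pi g) f).

Definition brace_degree m (ys : seq (homogeneous O)) : nat :=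
  (m + \sum_(y <- ys) (tag y).-1)%N.

(* [insert f [:: (i_1, g_1); ..; (i_k, g_k)]] plugs [g_k] into the input [i_k]
   of [f], then [g_(k-1)] into [i_(k-1)], and so on; for [i_1 < .. < i_k] the
   earlier positions are not shifted. *)
Definition insert (f : homogeneous O) (ps : seq (nat * homogeneous O)) :
    homogeneous O :=
  foldr (fun p h => homog (comp p.1 (tagged h) (tagged p.2))) f ps.

(* The exponent [sum_p |g_p| * s_p], where [s_p] is the number of inputs in
   front of [g_p] once [g_1, .., g_k] are inserted at the positions [t], the
   latter being counted from [0]. *)
Definition brace_sign (t : seq nat) (gs : seq (homogeneous O)) : nat :=
  let degs := [seq (tag g).-1 | g <- gs] in
  (\sum_(p < size gs) nth 0 degs p * (nth 0 t p + sumn (take p degs)))%N.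

(* [f{g_1, .., g_k}], a sum over all the increasing sequences of [k] inputs
   of [f]. *)
Definition operad_brace m (f : O m) (gs : seq (homogeneous O)) :
    O (brace_degree m gs) :=
  \sum_(t : (size gs).-tuple 'I_m | sorted ltn [seq val i | i <- t])
    (-1) ^+ (brace_sign [seq val i | i <- t] gs) *:
      part (brace_degree m gs)
        (tagged (insert (homog f) (zip [seq (val i).+1 | i <- t] gs))).

End Operad.

Arguments brace_degree {K O} m ys.

Section Algebras.
Variables (K : fieldType) (V : nat -> lmodType K).

Definition positive (ys : seq (homogeneous V)) : bool :=
  all (fun y => 0 < tag y)%N ys.

Record is_associative_product (dot : forall m n, V m -> V n -> V (m + n)) :
    Prop := {
  dot_bilinear : forall m n, (0 < m)%N -> (0 < n)%N -> bilinear_op (@dot m n);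
  dot_assoc : forall m n p (x : V m) (y : V n) (z : V p),
    (0 < m)%N -> (0 < n)%N -> (0 < p)%N ->
    forall k, part k (dot _ _ (dot _ _ x y) z) = part k (dot _ _ x (dot _ _ y z))
}.

Record is_differential (d : forall n, V n -> V n.+1) : Prop := {
  diff_linear : forall n, (0 < n)%N -> linear (@d n);
  diff_square : forall n (x : V n), (0 < n)%N -> d _ (d _ x) = 0
}.

Record is_dg_associative (dot : forall m n, V m -> V n -> V (m + n))
    (d : forall n, V n -> V n.+1) : Prop := {
  dg_product : is_associative_product dot;
  dg_differential : is_differential d;
  dg_leibniz : forall m n (x : V m) (y : V n), (0 < m)%N -> (0 < n)%N ->
    forall k, part k (d _ (dot _ _ x y))
            = part k (dot _ _ (d _ x) y) + (-1) ^+ m *: part k (dot _ _ x (d _ y))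
}.

Section Brace.
Variable brace : forall m, V m -> forall ys : seq (homogeneous V),
  V (brace_degree m ys).

(* For [bs = [:: (i_1, j_1); ..; (i_m, j_m)]] and [cur = 0], the sequence
   [y_1, .., y_(i_1), x_1{y_(i_1 + 1), .., y_(j_1)}, y_(j_1 + 1), ..,
    y_(i_m), x_m{y_(i_m + 1), .., y_(j_m)}, y_(j_m + 1), .., y_n]. *)
Fixpoint weave (cur : nat) (xs : seq (homogeneous V)) (bs : seq (nat * nat))
    (ys : seq (homogeneous V)) : seq (homogeneous V) :=
  match xs, bs with
  | x :: xs', (i, j) :: bs' =>
      drop cur (take i ys)
      ++ homog (brace (tagged x) (drop i (take j ys))) :: weave j xs' bs' ys
  | _, _ => drop cur ys
  end.

(* The exponent [sum_p |x_p| * (|y_1| + .. + |y_(i_p)|)]. *)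
Definition weave_sign (xs : seq (homogeneous V)) (bs : seq (nat * nat))
    (ys : seq (homogeneous V)) : nat :=
  (\sum_(q <- zip xs bs) (tag q.1).-1 * \sum_(y <- take q.2.1 ys) (tag y).-1)%N.

Definition nat_pairs n l (t : l.-tuple ('I_n.+1 * 'I_n.+1)) : seq (nat * nat) :=
  [seq (val b.1, val b.2) | b <- t].

(* [i_1 <= j_1 <= i_2 <= .. <= j_m] *)
Definition nested (bs : seq (nat * nat)) : bool :=
  sorted leq (flatten [seq [:: b.1; b.2] | b <- bs]).

Record is_brace_algebra : Prop := {
  brace_linear_l : forall m ys, (0 < m)%N -> positive ys ->
    linear (fun x : V m => brace x ys);
  brace_linear_r : forall m n (x : V m) ys zs (c : K) (u v : V n),
    (0 < m)%N -> (0 < n)%N -> positive ys -> positive zs ->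
    forall k, part k (brace x (ys ++ homog (c *: u + v) :: zs))
            = c *: part k (brace x (ys ++ homog u :: zs))
              + part k (brace x (ys ++ homog v :: zs));
  brace_nil : forall m (x : V m), (0 < m)%N ->
    forall k, part k (brace x [::]) = part k x;
  brace_brace : forall m (x : V m) xs ys,
    (0 < m)%N -> positive xs -> positive ys ->
    forall k, part k (brace (brace x xs) ys)
      = \sum_(t : (size xs).-tuple ('I_(size ys).+1 * 'I_(size ys).+1)
              | nested (nat_pairs t))
          (-1) ^+ (weave_sign xs (nat_pairs t) ys) *:
            part k (brace x (weave 0 xs (nat_pairs t) ys))
}.

Definition sdeg (ys : seq (homogeneous V)) : nat := (\sum_(y <- ys) (tag y).-1)%N.

(* The last two identities are those of Gerstenhaber and Voronov:
   [(x_1 x_2){y_1, .., y_n}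
     = sum_(0 <= k <= n) (-1)^((|x_2| + 1) (|y_1| + .. + |y_k|))
         x_1{y_1, .., y_k} x_2{y_(k+1), .., y_n}]
   and
   [d (x{x_1, .., x_(n+1)}) - (d x){x_1, .., x_(n+1)}
      - (-1)^|x| sum_(1 <= i <= n+1) (-1)^(|x_1| + .. + |x_(i-1)|)
          x{x_1, .., d x_i, .., x_(n+1)}
    = (-1)^((|x| + 1) |x_1|) x_1 x{x_2, .., x_(n+1)}
      - (-1)^|x| sum_(1 <= i <= n) (-1)^(|x_1| + .. + |x_i|)
          x{x_1, .., x_i x_(i+1), .., x_(n+1)}
      + (-1)^(|x| + |x_1| + .. + |x_n|) x{x_1, .., x_n} x_(n+1)].
   In [homotopyG_homotopy] the arguments [x_1, .., x_(n+1)] are both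
   [first :: rest] and [rcons init last]; the sums over [i] run over indices
   from [0]. *)
Record is_homotopy_G_algebra (dot : forall m n, V m -> V n -> V (m + n))
    (d : forall n, V n -> V n.+1) : Prop := {
  homotopyG_dg : is_dg_associative dot d;
  homotopyG_brace : is_brace_algebra;
  homotopyG_distributive : forall m1 m2 (x1 : V m1) (x2 : V m2) ys,
    (0 < m1)%N -> (0 < m2)%N -> positive ys ->
    forall k, part k (brace (dot _ _ x1 x2) ys)
      = \sum_(0 <= l < (size ys).+1) (-1) ^+ (m2 * sdeg (take l ys)) *:
          part k (dot _ _ (brace x1 (take l ys)) (brace x2 (drop l ys)));
  homotopyG_homotopy : forall m (x : V m) xs first last init rest,
    (0 < m)%N -> positive xs -> xs = first :: rest -> xs = rcons init last ->
    let D (y : homogeneous V) := homog (d _ (tagged y)) in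
    let M (y z : homogeneous V) := homog (dot _ _ (tagged y) (tagged z)) in
    let nth_x i := nth first xs i in
    forall k,
      part k (d _ (brace x xs)) - part k (brace (d _ x) xs)
      - (-1) ^+ m.-1 *: \sum_(0 <= i < size xs)
          (-1) ^+ (sdeg (take i xs)) *:
            part k (brace x (take i xs ++ D (nth_x i) :: drop i.+1 xs))
    = (-1) ^+ (m * (tag first).-1) *:
        part k (dot _ _ (tagged first) (brace x rest))
      - (-1) ^+ m.-1 *: \sum_(0 <= i < (size xs).-1)
          (-1) ^+ (sdeg (take i.+1 xs)) *:
            part k (brace x
              (take i xs ++ M (nth_x i) (nth_x i.+1) :: drop i.+2 xs))
      + (-1) ^+ (m.-1 + sdeg init) *:
          part k (dot _ _ (brace x init) (tagged last))
}.

End Brace.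

Record is_gerstenhaber_algebra (mul : forall m n, V m -> V n -> V (m + n))
    (br : forall m n, V m -> V n -> V (m + n).-1) : Prop := {
  gerst_product : is_associative_product mul;
  gerst_commutative : forall m n (x : V m) (y : V n), (0 < m)%N -> (0 < n)%N ->
    forall k, part k (mul _ _ x y) = (-1) ^+ (m * n) *: part k (mul _ _ y x);
  gerst_bilinear : forall m n, (0 < m)%N -> (0 < n)%N -> bilinear_op (@br m n);
  gerst_antisymmetric : forall m n (x : V m) (y : V n),
    (0 < m)%N -> (0 < n)%N ->
    forall k, part k (br _ _ x y)
            = - ((-1) ^+ (m.-1 * n.-1) *: part k (br _ _ y x));
  gerst_jacobi : forall m n p (x : V m) (y : V n) (z : V p),
    (0 < m)%N -> (0 < n)%N -> (0 < p)%N ->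
    forall k, part k (br _ _ x (br _ _ y z))
            = part k (br _ _ (br _ _ x y) z)
              + (-1) ^+ (m.-1 * n.-1) *: part k (br _ _ y (br _ _ x z));
  gerst_leibniz : forall m n p (x : V m) (y : V n) (z : V p),
    (0 < m)%N -> (0 < n)%N -> (0 < p)%N ->
    forall k, part k (br _ _ x (mul _ _ y z))
            = part k (mul _ _ (br _ _ x y) z)
              + (-1) ^+ (m.-1 * n) *: part k (mul _ _ y (br _ _ x z))
}.

End Algebras.

Section Cohomology.
Variables (K : fieldType) (C : nat -> lmodType K).
Variable d : forall n, {linear C n -> C n.+1}.

Definition is_cocycle n : {pred C n} := fun x => d n x == 0.

Fact is_cocycle_submod n : submod_closed (@is_cocycle n).
Proof.
split=> [|c x y]; rewrite !unfold_in ?linear0 ?eqxx //.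
by move=> /eqP dx /eqP dy; rewrite linearP dx dy scaler0 addr0.
Qed.
HB.instance Definition _ n :=
  GRing.isSubmodClosed.Build K (C n) (@is_cocycle n)
    (GRing.submod_closed_semi (@is_cocycle_submod n)).

Record cocycle n := Cocycle {
  cocycle_val :> C n;
  _ : cocycle_val \in @is_cocycle n
}.
HB.instance Definition _ n := [isSub for @cocycle_val n].
HB.instance Definition _ n := [Choice of cocycle n by <:].
HB.instance Definition _ n := [SubChoice_isSubLmodule of cocycle n by <:].

Definition boundary n : C n -> Prop :=
  match n with
  | 0 => fun x => x = 0
  | m.+1 => fun x => exists y : C m, x = d m y
  end.

Definition is_coboundary n : {pred cocycle n} := fun z => `[< boundary (val z) >].

Fact is_coboundary_submod n : submod_closed (@is_coboundary n).
Proof.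
split=> [|c x y].
  by apply/asboolP; case: n => [|n] //=; exists 0; rewrite linear0.
case: n x y => [|n] x y /asboolP bx /asboolP b_y; apply/asboolP.
  by rewrite /boundary linearP /= bx b_y scaler0 addr0.
case: bx b_y => [u eu] [v ev]; exists (c *: u + v).
by rewrite !linearP /= eu ev.
Qed.
HB.instance Definition _ n :=
  GRing.isSubmodClosed.Build K (cocycle n) (@is_coboundary n)
    (GRing.submod_closed_semi (@is_coboundary_submod n)).

Section CohomologyModule.
Variable n : nat.
Local Open Scope quotient_scope.
Local Notation Q := (Quotient.quot (@is_coboundary n)).

Definition coh_scale (c : K) (x : Q) : Q := \pi_Q (c *: repr x).

Fact coh_scale_pi c (z : cocycle n) : coh_scale c (\pi_Q z) = \pi_Q (c *: z).
Proof.
apply/eqP; rewrite /coh_scale -Quotient.idealrBE -scalerBr.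
by apply: rpredZ; rewrite [_ \in _]Quotient.idealrBE reprK.
Qed.

Fact coh_scaleA a b x : coh_scale a (coh_scale b x) = coh_scale (a * b) x.
Proof. by elim/quotW: x => z; rewrite (coh_scale_pi b z) !coh_scale_pi scalerA. Qed.

Fact coh_scale1 : left_id 1 coh_scale.
Proof. by elim/quotW=> z; rewrite coh_scale_pi scale1r. Qed.

Fact coh_scaleDr : right_distributive coh_scale +%R.
Proof.
move=> c; elim/quotW=> y; elim/quotW=> z.
by rewrite -raddfD !coh_scale_pi scalerDr raddfD.
Qed.

Fact coh_scaleDl x : {morph coh_scale^~ x : a b / a + b}.
Proof.
by elim/quotW: x => z a b; rewrite !coh_scale_pi scalerDl raddfD.
Qed.

HB.instance Definition _ := GRing.Zmodule_isLmodule.Build K Q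
  coh_scaleA coh_scale1 coh_scaleDr coh_scaleDl.

Definition cohomology : lmodType K := Q.
Definition coclass (z : cocycle n) : cohomology := \pi_Q z.

End CohomologyModule.

(* [opH] is well defined on classes by applying [op] to representatives. *)
Definition induced_by (deg : nat -> nat -> nat)
    (op : forall m n, C m -> C n -> C (deg m n))
    (opH : forall m n, cohomology m -> cohomology n -> cohomology (deg m n)) :
    Prop :=
  forall m n (f : cocycle m) (g : cocycle n), (0 < m)%N -> (0 < n)%N ->
    exists2 h : cocycle (deg m n),
      cocycle_val h = op _ _ f g & opH _ _ (coclass f) (coclass g) = coclass h.

End Cohomology.

Record is_hom_dendriform (K : fieldType) (A : lmodType K)
    (alpha : {linear A -> A}) (prec succ : {bilinear A -> A -> A}) : Prop := {
  dend_prec_prec : forall a b c,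
    prec (prec a b) (alpha c) = prec (alpha a) (prec b c + succ b c);
  dend_succ_prec : forall a b c,
    prec (succ a b) (alpha c) = succ (alpha a) (prec b c);
  dend_succ_succ : forall a b c,
    succ (prec a b + succ a b) (alpha c) = succ (alpha a) (succ b c);
  dend_alpha_prec : forall a b, alpha (prec a b) = prec (alpha a) (alpha b);
  dend_alpha_succ : forall a b, alpha (succ a b) = succ (alpha a) (alpha b)
}.

(* [K[C_n]] is ['rV[K]_n], with basis [cgen n 1, .., cgen n n]; a linear map on
   the tensor product of [K[C_n]] and the [n]-th tensor power of [A] is a map on
   ['rV[K]_n] and [{ffun 'I_n -> A}] that is linear in each of its [n + 1]
   variables.  For [n = 0] such a map vanishes, so that [cochain 0 = 0].  The
   indices [r] in [cgen], [R0] and [Ri] are counted from [1]. *)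

Section Cochains.
Variables (K : fieldType) (A : lmodType K) (alpha : {linear A -> A}).

Definition cgen n (r : nat) : 'rV[K]_n := \row_(s < n) (s.+1 == r)%:R.

Definition R0 (i n r : nat) : nat :=
  if (r <= i - 1)%N then r
  else if (r <= i + n - 1)%N then i
  else (r - n + 1)%N.

Definition Ri (i n r : nat) : 'rV[K]_n :=
  if (i <= r <= i + n - 1)%N then cgen n (r - (i - 1))
  else \sum_(1 <= s < n.+1) cgen n s.

Definition upd n (a : {ffun 'I_n -> A}) (j : 'I_n) (u : A) : {ffun 'I_n -> A} :=
  [ffun k => if k == j then u else a k].

Definition multilinear n (f : {ffun 'I_n -> A} -> A) : Prop :=
  forall (a : {ffun 'I_n -> A}) (j : 'I_n) (c : K) (u v : A),
    f (upd a j (c *: u + v)) = c *: f (upd a j u) + f (upd a j v).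

Definition cochain_fun n : Type := 'rV[K]_n -> {ffun 'I_n -> A} -> A.

Record cochain_axiom n (f : cochain_fun n) : Prop := {
  cochain_linear : forall a, linear (f^~ a);
  cochain_multilinear : forall v, multilinear (f v);
  cochain_alpha : forall r a, (1 <= r <= n)%N ->
    alpha (f (cgen n r) a) = f (cgen n r) [ffun k => alpha (a k)]
}.

Definition is_cochain n : {pred cochain_fun n} := fun f => `[< cochain_axiom f >].

Fact is_cochain_submod n : submod_closed (@is_cochain n).
Proof.
have ZE c (f g : cochain_fun n) v a : (c *: f + g) v a = c *: f v a + g v a.
  by [].
split=> [|c f g /asboolP[fl fm fa] /asboolP[gl gm ga]]; apply/asboolP.
  split=> [a c u v|v a j c x y|r a _]; rewrite /= ?scaler0 ?addr0 //.
  exact: linear0.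
split=> [a b u v|v a j b x y|r a rn]; rewrite ?ZE.
- by rewrite (fl a) (gl a) !scalerDr !scalerA (mulrC c) addrACA.
- by rewrite fm gm !scalerDr !scalerA (mulrC c) addrACA.
- by rewrite linearP fa // ga.
Qed.
HB.instance Definition _ n :=
  GRing.isSubmodClosed.Build K (cochain_fun n) (@is_cochain n)
    (GRing.submod_closed_semi (@is_cochain_submod n)).

Record cochain n := Cochain {
  cochain_val :> 'rV[K]_n -> {ffun 'I_n -> A} -> A;
  cochain_valP : cochain_val \in @is_cochain n
}.
HB.instance Definition _ n := [isSub for @cochain_val n].
HB.instance Definition _ n := [Choice of cochain n by <:].
HB.instance Definition _ n := [SubChoice_isSubLmodule of cochain n by <:].

Lemma cochainP n (f : cochain n) : cochain_axiom f.
Proof. exact/asboolP/cochain_valP. Qed.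

Lemma cochain_ext n (f g : cochain n) : (forall v a, f v a = g v a) -> f = g.
Proof.
by move=> fg; apply: val_inj; apply/funext=> v; apply/funext=> a; apply: fg.
Qed.

Lemma cochain_linE n (c : K) (f g : cochain n) v a :
  (c *: f + g) v a = c *: f v a + g v a.
Proof. by []. Qed.

(* [entry a 1, .., entry a n] are the components of [a]. *)
Definition entry n (a : {ffun 'I_n -> A}) (k : nat) : A :=
  oapp a 0 (insub k.-1).

Definition comp_arg m n i (g : cochain n) (r : nat)
    (a : {ffun 'I_(m + n).-1 -> A}) (k : nat) : A :=
  if (k < i)%N then iter n.-1 alpha (entry a k)
  else if k == i then g (Ri i n r) [ffun l : 'I_n => entry a (i + l)]
  else iter n.-1 alpha (entry a (k + n - 1)).

(* [comp_fun i f g (cgen _ r) a] is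
   [f (R_0 r; alpha^(n-1) a_1, .., g (R_i r; a_i, .., a_(i+n-1)), ..)]; the
   ordinals [r] and [k] are counted from [0]. *)
Definition comp_fun m n i (f : cochain m) (g : cochain n) :
    cochain_fun (m + n).-1 :=
  fun v a => \sum_(r < (m + n).-1)
    v 0 r *: f (cgen m (R0 i n r.+1)) [ffun k : 'I_m => comp_arg i g r.+1 a k.+1].

Lemma entry_upd n (a : {ffun 'I_n -> A}) j x k :
  entry (upd a j x) k = if k.-1 == j then x else entry a k.
Proof.
rewrite /entry; case: insubP => [l _ <-|] /=.
  by rewrite ffunE (inj_eq val_inj).
by case: eqP => // ->; rewrite ltn_ord.
Qed.

Lemma iter_alpha_linear n : linear (iter n alpha).
Proof. by move=> c u v; elim: n => //= n ->; rewrite linearP. Qed.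

Lemma R0_range m n i r : (1 <= i <= m)%N -> (0 < n)%N ->
  (1 <= r <= (m + n).-1)%N -> (1 <= R0 i n r <= m)%N.
Proof.
rewrite /R0 => im n0 rmn.
by case: ifP => ri; [|case: ifP => rin]; lia.
Qed.

Lemma Ri_alpha n (g : cochain n) i r a : (0 < i)%N -> (0 < n)%N ->
  alpha (g (Ri i n r) a) = g (Ri i n r) [ffun k => alpha (a k)].
Proof.
move=> i0 n0; have [gl _ ga] := cochainP g.
rewrite /Ri; case: ifP => [rn|_]; first by apply: ga; lia.
pose G b := HB.pack_for {linear 'rV[K]_n -> A} (g^~ b)
  (GRing.isLinear.Build _ _ _ _ (g^~ b) (gl b)).
rewrite -[LHS]/(alpha (G a _)) -[RHS]/(G _ _) !linear_sum /=.
by rewrite !big_nat; apply: eq_bigr => s sn; apply: ga; lia.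
Qed.

Fact comp_fun_cochain m n i (f : cochain m) (g : cochain n) :
  (1 <= i <= m)%N -> (0 < n)%N -> cochain_axiom (comp_fun i f g).
Proof.
move=> im n0; have [fl fm fa] := cochainP f; have [gl gm ga] := cochainP g.
split=> [a c u v|v a j c x y|r a rn].
- rewrite /comp_fun scaler_sumr -big_split; apply: eq_bigr => r _ /=.
  by rewrite !mxE scalerDl scalerA.
- rewrite /comp_fun scaler_sumr -big_split; apply: eq_bigr => r _ /=.
  rewrite scalerA mulrC -scalerA -scalerDr; congr (_ *: _).
  suff [phi [j' [phil E]]] : exists phi : A -> A, exists j' : 'I_m,
      linear phi /\ forall z, [ffun k : 'I_m => comp_arg i g r.+1 (upd a j z) k.+1]
        = upd [ffun k : 'I_m => comp_arg i g r.+1 a k.+1] j' (phi z).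
    by rewrite !E phil fm.
  have jl := ltn_ord j.
  have [ji|ij] := ltnP j.+1 i.
    have jm : (j < m)%N by lia.
    exists (iter n.-1 alpha), (Ordinal jm); split; first exact: iter_alpha_linear.
    move=> z; apply/ffunP=> k; rewrite !ffunE /comp_arg !entry_upd -val_eqE /=.
    case: ifP => ki; first by case: ifP.
    have -> : (k == j :> nat) = false by lia.
    have -> : ((k.+1 + n - 1).-1 == j) = false by lia.
    case: ifP => // _; congr (g _ _); apply/ffunP=> l; rewrite !ffunE entry_upd.
    by have -> : ((i + l).-1 == j) = false by lia.
  have [jin|inj] := ltnP j.+1 (i + n).
    have im' : (i.-1 < m)%N by lia.
    have jn : (j.+1 - i < n)%N by lia.
    pose b := [ffun l : 'I_n => entry a (i + l)].
    exists (fun z => g (Ri i n r.+1) (upd b (Ordinal jn) z)), (Ordinal im').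
    split=> [d z t|z]; first exact: gm.
    apply/ffunP=> k; rewrite !ffunE /comp_arg !entry_upd -val_eqE /=.
    case: ifP => ki.
      have -> : (k == i.-1 :> nat) = false by lia.
      by have -> : (k == j :> nat) = false by lia.
    have -> : (k == i.-1 :> nat) = (k.+1 == i) by lia.
    case: ifP => [ki'|ki'].
      congr (g _ _); apply/ffunP=> l; rewrite !ffunE entry_upd -val_eqE /=.
      by have -> : ((i + l).-1 == j) = (l == j.+1 - i :> nat)%N by lia.
    by have -> : ((k.+1 + n - 1).-1 == j) = false by lia.
  have jm : (j.+1 - n < m)%N by lia.
  exists (iter n.-1 alpha), (Ordinal jm); split; first exact: iter_alpha_linear.
  move=> z; apply/ffunP=> k; rewrite !ffunE /comp_arg !entry_upd -val_eqE /=.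
  case: ifP => ki.
    have -> : (k == j.+1 - n :> nat)%N = false by lia.
    by have -> : (k == j :> nat) = false by lia.
  case: ifP => ki'.
    have -> : (k == j.+1 - n :> nat)%N = false by lia.
    congr (g _ _); apply/ffunP=> l; rewrite !ffunE entry_upd.
    by have -> : ((i + l).-1 == j) = false by (have := ltn_ord l; lia).
  have -> : ((k.+1 + n - 1).-1 == j) = (k == j.+1 - n :> nat)%N by lia.
  by case: ifP.
have entry_alpha k (l : nat) (b : {ffun 'I_k -> A}) :
    entry [ffun q => alpha (b q)] l = alpha (entry b l).
  by rewrite /entry; case: insubP => [q _ _|_] /=; rewrite ?ffunE ?linear0.
rewrite /comp_fun linear_sum; apply: eq_bigr => s _.
rewrite linearZ /= fa; last by apply: R0_range => //=.
congr (_ *: f _ _); apply/ffunP=> k; rewrite !ffunE /comp_arg.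
case: ifP => _; first by rewrite entry_alpha -iterS -iterSr.
case: ifP => _; last by rewrite entry_alpha -iterS -iterSr.
rewrite Ri_alpha //; last by case/andP: im.
congr (g _ _); apply/ffunP=> l.
by rewrite !ffunE entry_alpha.
Qed.

Fact comp_subproof m n i (f : cochain m) (g : cochain n) :
  (if (1 <= i <= m)%N && (0 < n)%N then comp_fun i f g else 0)
    \in @is_cochain (m + n).-1.
Proof.
case: ifP => [/andP[im n0]|_]; last exact: rpred0.
exact/asboolP/comp_fun_cochain.
Qed.

Definition cochain_comp m n (i : nat) (f : cochain m) (g : cochain n) :
    cochain (m + n).-1 := Cochain (comp_subproof i f g).

Lemma cochain_compE m n i (f : cochain m) (g : cochain n) v a :
  cochain_comp i f g v a =
    if (1 <= i <= m)%N && (0 < n)%N then comp_fun i f g v a else 0.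
Proof. by rewrite /cochain_comp /=; case: ifP. Qed.

Fact cochain_comp_bilinear m n i : bilinear_op (@cochain_comp m n i).
Proof.
split=> [g c f1 f2|f c g1 g2]; apply: cochain_ext => v a;
    rewrite cochain_linE !cochain_compE;
    case: ifP => [/andP[im n0]|_]; rewrite ?scaler0 ?addr0 //;
    rewrite /comp_fun scaler_sumr -big_split;
    apply: eq_bigr => r _; rewrite [RHS]/=.
  by rewrite cochain_linE scalerDr !scalerA mulrC.
rewrite scalerA mulrC -scalerA -scalerDr; congr (_ *: _).
have im' : (i.-1 < m)%N by lia.
pose y g : A := g (Ri i n r.+1) [ffun l : 'I_n => entry a (i + l)].
have [b E] : exists b, forall g : cochain n,
    [ffun k : 'I_m => comp_arg i g r.+1 a k.+1] = upd b (Ordinal im') (y g).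
  exists [ffun k : 'I_m => comp_arg i g1 r.+1 a k.+1] => g.
  apply/ffunP=> k; rewrite !ffunE.
  have -> : (k == Ordinal im') = (k.+1 == i) by rewrite -val_eqE /=; lia.
  rewrite /comp_arg; have [->|_] := eqVneq k.+1 i; last reflexivity.
  by rewrite ltnn.
have yE : y (c *: g1 + g2) = c *: y g1 + y g2 by exact: cochain_linE.
by rewrite !E yE (cochain_multilinear (cochainP f)).
Qed.

Definition id_fun : cochain_fun 1 := fun v a => v 0 0 *: a 0.

Fact id_fun_cochain : id_fun \in @is_cochain 1.
Proof.
apply/asboolP; split=> [a c u v|v a j c x y|r a rn]; rewrite /id_fun.
- by rewrite !mxE scalerDl scalerA.
- by rewrite !ffunE (ord1 j) eqxx scalerDr !scalerA mulrC.
- by rewrite linearZ ffunE.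
Qed.

Definition cochain_id : cochain 1 := Cochain id_fun_cochain.

End Cochains.

Section HomDendriform.
Variables (K : fieldType) (A : lmodType K) (alpha : {linear A -> A}).
Variables (prec succ : {bilinear A -> A -> A}).
Hypothesis hA : is_hom_dendriform alpha prec succ.

(* [ord0] and [ord_max] are the two elements of ['I_2]: this is the map with
   [pi([1]; a, b) = prec a b] and [pi([2]; a, b) = succ a b]. *)
Definition pi_fun : cochain_fun A 2 := fun v a =>
  v 0 ord0 *: prec (a ord0) (a ord_max) + v 0 ord_max *: succ (a ord0) (a ord_max).

Fact pi_fun_cochain : pi_fun \in @is_cochain K A alpha 2.
Proof.
apply/asboolP; split=> [a c u v|v a j c x y|r a rn]; rewrite /pi_fun.
- by rewrite !mxE !scalerDl scalerDr !scalerA addrACA.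
- have [->|->] : j = ord0 \/ j = ord_max.
    by case: j => [[|[|//]]] ?; [left|right]; apply: val_inj.
  + rewrite !ffunE /= !linearPl !scalerDr !scalerA.
    by rewrite ![_ * c]mulrC addrACA.
  + rewrite !ffunE /= !linearPr !scalerDr !scalerA.
    by rewrite ![_ * c]mulrC addrACA.
- by rewrite linearD !linearZ !ffunE /= (dend_alpha_prec hA) (dend_alpha_succ hA).
Qed.

Definition dend_pi : cochain alpha 2 := Cochain pi_fun_cochain.

Definition dend_diff n (f : cochain alpha n) : cochain alpha n.+1 :=
  operad_diff (@cochain_comp K A alpha) dend_pi f.

Fact dend_diff_linear n : linear (@dend_diff n).
Proof.
exact: operad_diff_linear (@cochain_comp_bilinear K A alpha).
Qed.
HB.instance Definition _ n := GRing.isLinear.Build K (cochain alpha n)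
  (cochain alpha n.+1) _ (@dend_diff n) (@dend_diff_linear n).

Definition dend_dot m n (f : cochain alpha m) (g : cochain alpha n) :
    cochain alpha (m + n) :=
  operad_dot (@cochain_comp K A alpha) dend_pi f g.

Definition dend_bracket m n (f : cochain alpha m) (g : cochain alpha n) :
    cochain alpha (m + n).-1 :=
  operad_bracket (@cochain_comp K A alpha) f g.

Definition dend_complex n : {linear cochain alpha n -> cochain alpha n.+1} :=
  @dend_diff n.

Definition dend_cohomology (n : nat) : lmodType K := cohomology dend_complex n.

End HomDendriform.

Arguments cochain_comp {K A} alpha m n i f g.
Arguments dend_diff {K A alpha prec succ} hA n f.
Arguments dend_dot {K A alpha prec succ} hA m n f g.
Arguments dend_bracket {K A} alpha m n f g.
Arguments dend_complex {K A alpha prec succ} hA n.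

(* Main.v *)
Require Import Defs.
From HB Require Import structures.
From mathcomp Require Import all_boot all_order all_algebra.
From mathcomp Require Import boolp zify ring.

Set Implicit Arguments.
Unset Strict Implicit.
Unset Printing Implicit Defensive.

Import GRing.Theory.
Local Open Scope ring_scope.

(** Degrees such as m + n - 1 + p - 1 are equal along the axioms but rarely convertible. The brace
    calculus is therefore done with letters [(b, y)], where [y] lies in one fixed module and the
    shifted degree [b] is a plain number. An operad enters through the direct product of its
    components: [embed] is injective on each component and an equation in degree k is read off by
    [component k]. The state [(r, c)] of the recursion counts remaining and passed inputs, the
    inputs of inserted letters being counted among the passed ones. Sign exponents are thus visible
    at each step and later positions need no renumbering. What is left after expanding braces is
    linear up to parities, which is why a reflective tactic for signed module identities comes
    first. The identities concern positive degrees only. A coboundary of degree one comes from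
    degree zero, so the passage to cohomology uses that cochains of degree zero vanish. *)

(** Partial compositions of any nonsymmetric operad determine the braces
    [f{g_1, .., g_k}].  Reading the inputs of [f] from left to right, each input
    is either skipped or filled with the next [g_i]; this turns the brace into a
    recursion on the number of remaining inputs, in which the sign is the parity
    of |g_i| times the number of inputs passed so far.  The brace identity follows by
    induction on that number, comparing the first input on both sides, and only
    needs the sequential and parallel axioms.  With a multiplication [pi], the
    product and the differential are braces with [pi], so every other identity is
    the brace identity for words in which [pi] occurs, together with [pi{pi} = 0]
    and the vanishing of [pi] on more than two letters.  On cohomology,
    [d (x{y})] makes the product commutative and [d (x{y, z})] makes the bracket a
    derivation.

    The cochains form an operad because [R0] and [Ri] satisfy the coassociativity
    relations dual to the operad axioms, the value [[1] + .. + [n]] of [Ri] being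
    treated as one more index on which these maps are constant. *)

(** * Linear identities up to signs *)

Section ModuleExpressions.
Variables (K : comNzRingType) (X : lmodType K).

Inductive mexp :=
  MVar of nat | MZero | MAdd of mexp & mexp | MOpp of mexp | MScale of K & mexp.

Fixpoint meval (env : seq X) e : X :=
  match e with
  | MVar i => env`_i
  | MZero => 0
  | MAdd e1 e2 => meval env e1 + meval env e2
  | MOpp e1 => - meval env e1
  | MScale c e1 => c *: meval env e1
  end.

(** [Nat.eqb] reduces under [cbn] on numerals, so each coefficient becomes a plain ring
    expression. *)
Fixpoint mcoef e (i : nat) : K :=
  match e with
  | MVar j => if Nat.eqb i j then 1 else 0
  | MZero => 0
  | MAdd e1 e2 => mcoef e1 i + mcoef e2 i
  | MOpp e1 => - mcoef e1 i
  | MScale c e1 => c * mcoef e1 i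
  end.

Lemma mevalE env e : meval env e = \sum_(i < size env) mcoef e i *: env`_i.
Proof.
elim: e => [j||e1 IH1 e2 IH2|e1 IH1|c e1 IH1] /=.
- have natE (i k : nat) : Nat.eqb i k = (i == k) by elim: i k => [|i IH] [|k] //=.
  have [ji|ij] := ltnP j (size env).
    rewrite (bigD1 (Ordinal ji)) //= natE eqxx scale1r big1 ?addr0 // => i.
    by rewrite -val_eqE /= natE => /negPf ->; rewrite scale0r.
  rewrite nth_default // big1 // => i _; rewrite natE; case: eqP => [e|]; last by rewrite scale0r.
  by have := ltn_ord i; rewrite e ltnNge ij.
- by rewrite big1 // => i _; rewrite scale0r.
- by rewrite IH1 IH2 -big_split; apply: eq_bigr => i _; rewrite scalerDl.
- by rewrite IH1 -sumrN; apply: eq_bigr => i _; rewrite scaleNr.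
- by rewrite IH1 scaler_sumr; apply: eq_bigr => i _; rewrite scalerA.
Qed.

Fixpoint mcoef_eq e1 e2 (n : nat) : Prop :=
  match n with
  | 0 => True
  | n'.+1 => mcoef e1 n' = mcoef e2 n' /\ mcoef_eq e1 e2 n'
  end.

Lemma meval_eq env e1 e2 : mcoef_eq e1 e2 (size env) ->
  meval env e1 = meval env e2.
Proof.
rewrite !mevalE; elim: (size env) => [|n IH] /=; first by rewrite !big_ord0.
by case=> e /IH; rewrite !big_ord_recr /= => ->; rewrite e.
Qed.

End ModuleExpressions.

(** The inner [match constr:(Set)] runs [unify] while a term is being built; its failure makes the
    outer match try the next atom. *)
Ltac find_index x l k :=
  lazymatch l with
  | ?y :: ?l' =>
      match constr:(Set) with
      | _ => let _ := match constr:(Set) with _ => unify x y end in constr:(k)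
      | _ => find_index x l' (S k)
      end
  end.
Ltac add_atom x l :=
  match l with
  | nil => constr:([:: x])
  | cons ?y _ => let _ := match constr:(Set) with _ => unify x y end in constr:(l)
  | cons ?y ?l' => let r := add_atom x l' in constr:(y :: r)
  end.
Ltac atoms t l :=
  lazymatch t with
  | (?a + ?b)%R => let l1 := atoms a l in atoms b l1
  | (- ?a)%R => atoms a l
  | (_ *: ?a)%R => atoms a l
  | 0%R => constr:(l)
  | _ => add_atom t l
  end.
Ltac reify K t l :=
  lazymatch t with
  | (?a + ?b)%R => let u := reify K a l in let v := reify K b l in constr:(MAdd u v)
  | (- ?a)%R => let u := reify K a l in constr:(MOpp u)
  | (?c *: ?a)%R => let u := reify K a l in constr:(MScale c u)
  | 0%R => constr:(MZero K)
  | _ => let i := find_index t l 0%nat in constr:(MVar K i)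
  end.
(** A sign depends only on the parity of its exponent. Exponents that are booleans, 0 or 1 are
    skipped, as rewriting them would loop. *)
Ltac split_signs :=
  repeat match goal with
    |- context [@GRing.exp ?R ?x ?e] =>
      lazymatch e with nat_of_bool _ => fail | O => fail | S O => fail | _ =>
      rewrite -(@signr_odd _ e) ?(oddD, oddM, oddS, negbK) /= end
  end.
Ltac sign_cases := split_signs;
  repeat match goal with |- context [odd ?n] => case: (odd n) end; rewrite /= ?expr0 ?expr1; ring.
(* Compares the coefficients of the atoms of a module equation in the scalar
   ring, splitting on the parities of the exponents of [-1]. *)
Ltac modulo_signs :=
  lazymatch goal with |- @eq ?X ?a ?b =>
    let l0 := atoms a (@nil X) in let l := atoms b l0 in
    lazymatch goal with |- context [@GRing.scale ?K ?V _ _] =>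
    let u := reify K a l in let v := reify K b l in
    apply: (@meval_eq K V l u v) end
  end; cbn -[GRing.exp GRing.add GRing.mul GRing.opp GRing.zero GRing.one];
  repeat split; try ring; sign_cases.

(** * Braces in an ungraded module *)

(* [o c x y] inserts [y] into the input of [x] that has [c] inputs in front of
   it, and [sd a x] says that [x] has [a + 1] inputs; having all elements in
   one module [X] avoids transports between degrees. *)
Record graded_composition (K : fieldType) (X : lmodType K)
    (o : nat -> X -> X -> X) (sd : nat -> X -> Prop) : Prop := {
  comp_linear_l : forall c G, linear (fun F => o c F G);
  comp_linear_r : forall c F, linear (o c F);
  sdeg_zero : forall a, sd a 0;
  sdeg_add : forall a F G, sd a F -> sd a G -> sd a (F + G);
  sdeg_scale : forall a k F, sd a F -> sd a (k *: F);
  sdeg_comp : forall a b c F G, sd a F -> sd b G -> (c <= a)%N ->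
    sd (a + b)%N (o c F G);
  comp_sequential : forall a b e c j F G H, sd a F -> sd b G -> sd e H ->
    (c <= a)%N -> (j <= b)%N -> o (c + j)%N (o c F G) H = o c F (o j G H);
  comp_parallel : forall a b e i j F G H, sd a F -> sd b G -> sd e H ->
    (i < j)%N -> (j <= a)%N -> o (j + b)%N (o i F G) H = o i (o j F H) G
}.

Section Plugging.
Variables (K : fieldType) (X : lmodType K).
Variables (o : nat -> X -> X -> X) (sd : nat -> X -> Prop).
Hypothesis go : graded_composition o sd.

Let o_linear_l := comp_linear_l go.
Let o_linear_r := comp_linear_r go.
Let sd0 := sdeg_zero go.
Let sdD := sdeg_add go.
Let sdZ := sdeg_scale go.
Let sd_o := sdeg_comp go.
Let o_seq := comp_sequential go.
Let o_par := comp_parallel go.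

Implicit Types (r c : nat) (F G H : X) (x y : nat * X) (xs ys : seq (nat * X)).

Lemma oDl c H F G : o c (F + G) H = o c F H + o c G H.
Proof. by rewrite -[F]scale1r o_linear_l !scale1r. Qed.
Lemma oDr c H F G : o c H (F + G) = o c H F + o c H G.
Proof. by rewrite -[F]scale1r o_linear_r !scale1r. Qed.
Lemma o0l c H : o c 0 H = 0.
Proof. by have := oDl c H 0 0; rewrite addr0 => /esym/eqP; rewrite -subr_eq0 addrK => /eqP. Qed.
Lemma o0r c H : o c H 0 = 0.
Proof. by have := oDr c H 0 0; rewrite addr0 => /esym/eqP; rewrite -subr_eq0 addrK => /eqP. Qed.
Lemma oZl c H k F : o c (k *: F) H = k *: o c F H.
Proof. by have := o_linear_l c H k F 0; rewrite o0l !addr0. Qed.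
Lemma oZr c H k F : o c H (k *: F) = k *: o c H F.
Proof. by have := o_linear_r c H k F 0; rewrite o0r !addr0. Qed.

(* [F] has [c + r] inputs, of which the first [c] are kept as they are; the
   letters [(b, y)] carry the shifted degree [b] of [y]. *)
Fixpoint plug_rec r c F ys : X :=
  match r, ys with
  | _, [::] => F
  | 0, _ => 0
  | r'.+1, y :: ys' =>
      plug_rec r' c.+1 F ys
      + (-1) ^+ (c * y.1) *: plug_rec r' (c + y.1).+1 (o c F y.2) ys'
  end.

(** Locking keeps simplification from unfolding the recursion; [plug_nil], [plug_none] and
    [plug_cons] replace computation. *)
Fact plug_key : unit. Proof. exact: tt. Qed.
Definition plug := locked_with plug_key plug_rec.

Definition shdeg ys : nat := (\sum_(y <- ys) y.1)%N.

Lemma shdeg_nil : shdeg [::] = 0%N. Proof. exact: big_nil. Qed.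
Lemma shdeg_cons y ys : shdeg (y :: ys) = (y.1 + shdeg ys)%N. Proof. exact: big_cons. Qed.
Lemma shdeg_cat xs ys : shdeg (xs ++ ys) = (shdeg xs + shdeg ys)%N. Proof. exact: big_cat. Qed.
Definition shdegE := (shdeg_nil, shdeg_cons, shdeg_cat).
Lemma shdeg_take_drop l ys : shdeg ys = (shdeg (take l ys) + shdeg (drop l ys))%N.
Proof. by rewrite -shdeg_cat cat_take_drop. Qed.

Lemma plug_nil r c F : plug r c F [::] = F.
Proof. by rewrite [plug]unlock; case: r. Qed.
Lemma plug_none c F y ys : plug 0 c F (y :: ys) = 0.
Proof. by rewrite [plug]unlock. Qed.
Lemma plug_cons r c F y ys : plug r.+1 c F (y :: ys) =
  plug r c.+1 F (y :: ys) + (-1) ^+ (c * y.1) *: plug r (c + y.1).+1 (o c F y.2) ys.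
Proof. by rewrite [plug]unlock. Qed.

Lemma plug_linear r c ys : linear (fun F => plug r c F ys).
Proof.
elim: r c ys => [|r IH] c [|y ys] k F G; rewrite ?plug_nil //.
  by rewrite !plug_none scaler0 addr0.
rewrite !plug_cons oDl oZl !IH; modulo_signs.
Qed.
Lemma plugD r c ys F G : plug r c (F + G) ys = plug r c F ys + plug r c G ys.
Proof. by rewrite -[F]scale1r plug_linear !scale1r. Qed.
Lemma plug0 r c ys : plug r c 0 ys = 0.
Proof.
by have := plugD r c ys 0 0; rewrite addr0 => /esym/eqP; rewrite -subr_eq0 addrK => /eqP.
Qed.
Lemma plugZ r c ys k F : plug r c (k *: F) ys = k *: plug r c F ys.
Proof. by have := plug_linear r c ys k F 0; rewrite plug0 !addr0. Qed.

Lemma plug_linear_r r c F us b k u v ws :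
  plug r c F (us ++ (b, k *: u + v) :: ws) =
  k *: plug r c F (us ++ (b, u) :: ws) + plug r c F (us ++ (b, v) :: ws).
Proof.
elim: r c F us => [|r IH] c F [|y us]; rewrite ?plug_none ?scaler0 ?addr0 //.
  have /= IH0 := IH c.+1 F [::].
  by rewrite !plug_cons IH0 oDr oZr plugD plugZ /=; modulo_signs.
by rewrite !cat_cons !plug_cons -!cat_cons !IH !cat_cons; modulo_signs.
Qed.
Lemma plug_zero_r r c F us b ws : plug r c F (us ++ (b, 0) :: ws) = 0.
Proof.
have := plug_linear_r r c F us b 1 0 0 ws; rewrite scale1r addr0 scale1r.
by move=> /esym/eqP; rewrite -subr_eq0 addrK => /eqP.
Qed.
Lemma plugDr r c F us b u v ws :
  plug r c F (us ++ (b, u + v) :: ws) =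
  plug r c F (us ++ (b, u) :: ws) + plug r c F (us ++ (b, v) :: ws).
Proof. by have := plug_linear_r r c F us b 1 u v ws; rewrite !scale1r. Qed.
Lemma plugZr r c F us b k u ws :
  plug r c F (us ++ (b, k *: u) :: ws) = k *: plug r c F (us ++ (b, u) :: ws).
Proof. by have := plug_linear_r r c F us b k u 0 ws; rewrite plug_zero_r !addr0. Qed.

Lemma plug_overfull r c F ys : (r < size ys)%N -> plug r c F ys = 0.
Proof.
elim: r c F ys => [|r IH] c F [|y ys] // rs; first by rewrite plug_none.
by rewrite plug_cons !IH ?scaler0 ?addr0 //=; move: rs => /=; lia.
Qed.

Definition homog_letters ys : Prop := forall y, y \in ys -> sd y.1 y.2.

Lemma homog_letters_cons y ys : homog_letters (y :: ys) <-> sd y.1 y.2 /\ homog_letters ys.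
Proof.
split=> [h|[hy h] z]; last by rewrite inE => /orP[/eqP ->|/h].
by split=> [|z zs]; apply: h; rewrite inE ?eqxx ?zs ?orbT.
Qed.
Lemma homog_letters_cat xs ys : homog_letters (xs ++ ys) <-> homog_letters xs /\ homog_letters ys.
Proof.
split=> [h|[h1 h2] z]; last by rewrite mem_cat => /orP[/h1|/h2].
by split=> z zs; apply: h; rewrite mem_cat zs ?orbT.
Qed.
Lemma homog_letters_take l ys : homog_letters ys -> homog_letters (take l ys).
Proof. by rewrite -{1}(cat_take_drop l ys) => /homog_letters_cat[]. Qed.
Lemma homog_letters_drop l ys : homog_letters ys -> homog_letters (drop l ys).
Proof. by rewrite -{1}(cat_take_drop l ys) => /homog_letters_cat[]. Qed.

(** The equation [a.+1 = c + r] is the invariant of the recursion: filling an input with a letter of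
    degree b raises a by b, raises c by b + 1 and lowers r by 1. It keeps all insertions within
    range. *)
Lemma sd_plug r c a F ys : sd a F -> a.+1 = (c + r)%N -> homog_letters ys ->
  sd (a + shdeg ys) (plug r c F ys).
Proof.
elim: r c a F ys => [|r IH] c a F [|y ys] hF e hys;
  rewrite ?plug_nil ?plug_none ?shdegE ?addn0 //.
move: (hys) => /homog_letters_cons[hy hys']; rewrite plug_cons; apply: sdD.
  by rewrite -shdeg_cons; apply: IH => //; lia.
apply: sdZ; rewrite addnA; apply: IH => //; last by lia.
by apply: sd_o => //; lia.
Qed.

(** An insertion in front of all remaining inputs commutes with the later ones by the parallel
    axiom. Done first, it puts b more inputs in front of every letter of [ys], whence the sign. *)
Lemma plug_swap r c c' a F b (y : X) ys : sd a F -> a.+1 = (c + r)%N -> (c' < c)%N ->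
  sd b y -> homog_letters ys ->
  o c' (plug r c F ys) y = (-1) ^+ (b * shdeg ys) *: plug r (c + b) (o c' F y) ys.
Proof.
elim: r c a F ys => [|r IH] c a F [|z ys] hF e cc hy hys;
  rewrite ?plug_nil ?plug_none ?shdeg_nil ?muln0 ?scale1r ?o0l ?scaler0 //.
move: (hys) => /homog_letters_cons[hz hys'].
rewrite !plug_cons oDl oZl (IH _ a) //; [|lia|lia].
rewrite (IH _ (a + z.1)%N) //; [|by apply: sd_o => //; lia|lia|lia].
rewrite addSn shdeg_cons -(o_par hF hy hz cc) //; last by lia.
by rewrite addSn [(c + z.1 + b)%N]addnAC; modulo_signs.
Qed.

(* The letters [ys] are distributed between the remaining [s] inputs of [x] and
   the [r] inputs of [F] behind [x]. *)
Lemma plug_comp r s c d a e F (x : X) ys : sd a F -> sd e x -> e.+1 = (d + s)%N ->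
  a = (c + r)%N -> homog_letters ys ->
  plug (s + r) (c + d) (o c F x) ys = \sum_(0 <= l < (size ys).+1)
    (-1) ^+ (c * shdeg (take l ys)) *:
      plug r (c + d + s + shdeg (take l ys)) (o c F (plug s d x (take l ys))) (drop l ys).
Proof.
move=> hF; elim: s d e x ys => [|s IH] d e x ys hx ed ac hys.
  rewrite big_nat_recl // take0 drop0 shdeg_nil muln0 scale1r plug_nil !addn0.
  rewrite big_nat big1 ?addr0 // => l ls.
  have sz : size (take l.+1 ys) = l.+1 by rewrite size_takel //; lia.
  (* No input of [x] remains, so only the empty prefix, l = 0, contributes. *)
  rewrite [plug 0 _ _ _]plug_overfull ?sz //.
  by rewrite o0r plug0 scaler0.
case: ys hys => [|y ys] hys.
  by rewrite plug_nil /= big_nat1 /= shdeg_nil muln0 scale1r !plug_nil.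
move: (hys) => /homog_letters_cons[hy hys'].
rewrite addSn plug_cons.
have -> : (c + d).+1 = (c + d.+1)%N by lia.
rewrite (IH _ e) //; last by lia.
rewrite (o_seq hF hx hy); [|lia|lia].
have -> : (c + d + y.1).+1 = (c + (d + y.1).+1)%N by lia.
rewrite (IH _ (e + y.1)%N) //; [|by apply: sd_o => //; lia|lia].
(* The terms l = 0 agree. In the term l + 1 on the right, [plug_cons] splits the brace of [x]
   according to whether its input d is skipped or receives [y]; these are the two sums on the
   left. *)
rewrite big_nat_recl // [in RHS]big_nat_recl //= shdeg_nil muln0 scale1r.
rewrite !addn0 !plug_nil.
have -> : (c + d + s.+1 = c + d.+1 + s)%N by lia.
rewrite expr0 !scale1r -addrA; congr (_ + _).
rewrite scaler_sumr -big_split; apply: eq_bigr => l _ /=.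
rewrite shdeg_cons plug_cons oDr oZr plugD plugZ.
have -> : (c + (d + y.1).+1 + s + shdeg (take l ys)
    = c + d.+1 + s + (y.1 + shdeg (take l ys)))%N by lia.
modulo_signs.
Qed.

(** * Iterated braces *)

Definition brace_letter x ys : nat * X := ((x.1 + shdeg ys)%N, plug x.1.+1 0 x.2 ys).

(* The right-hand side of the brace identity, [phi] being applied to the words
   made of the [x_p{..}] and of the remaining [y]; the sign of [y] in front of
   [x_p] is collected when [y] is read. *)
Fixpoint weaves xs (phi : seq (nat * X) -> X) ys : X :=
  if xs is x :: xs' then
    \sum_(0 <= i < (size ys).+1) (-1) ^+ (shdeg (take i ys) * shdeg xs) *:
      \sum_(0 <= l < (size (drop i ys)).+1)
        (-1) ^+ (shdeg xs' * shdeg (take l (drop i ys))) *: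
        weaves xs' (fun w => phi (take i ys ++ brace_letter x (take l (drop i ys)) :: w))
          (drop l (drop i ys))
  else phi ys.

Lemma weaves_nil_r x xs phi : weaves (x :: xs) phi [::] =
  weaves xs (fun w => phi (brace_letter x [::] :: w)) [::].
Proof. by rewrite /= !big_nat1 /= shdeg_nil mul0n muln0 !scale1r. Qed.

(** The output word begins either with a brace of [x] (i = 0) or with [y], which then stands in
    front of all of [x :: xs]. This matches what can fill the first input in [plug_plug]. *)
Lemma weaves_cons x xs phi y ys : weaves (x :: xs) phi (y :: ys) =
  \sum_(0 <= l < (size ys).+2) (-1) ^+ (shdeg xs * shdeg (take l (y :: ys))) *:
    weaves xs (fun w => phi (brace_letter x (take l (y :: ys)) :: w)) (drop l (y :: ys))
  + (-1) ^+ (y.1 * shdeg (x :: xs)) *: weaves (x :: xs) (fun w => phi (y :: w)) ys.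
Proof.
rewrite [LHS]/=; rewrite big_nat_recl // take0 drop0 shdeg_nil mul0n scale1r /=.
congr (_ + _); rewrite scaler_sumr; apply: eq_bigr => i _ /=.
by rewrite scalerA -exprD shdeg_cons mulnDl.
Qed.

Lemma eq_weaves xs phi psi ys : phi =1 psi -> weaves xs phi ys = weaves xs psi ys.
Proof. by move=> e; have -> // : phi = psi by apply/funext. Qed.

Lemma weaves_linear xs k phi psi ys :
  weaves xs (fun w => k *: phi w + psi w) ys = k *: weaves xs phi ys + weaves xs psi ys.
Proof.
elim: xs phi psi ys => //= x xs IH phi psi ys.
rewrite [k *: _]scaler_sumr -big_split; apply: eq_bigr => i _ /=.
rewrite [k *: _]scalerA [k * _]mulrC -scalerA -scalerDr; congr (_ *: _).
rewrite scaler_sumr -big_split.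
apply: eq_bigr => l _ /=; rewrite IH scalerDr !scalerA; congr (_ *: _ + _).
by rewrite mulrC.
Qed.

Lemma weaves_zero xs ys : weaves xs (fun _ => 0) ys = 0.
Proof.
elim: xs ys => //= x xs IH ys; apply: big1 => i _.
by rewrite big1 ?scaler0 // => l _; rewrite IH scaler0.
Qed.

Lemma weaves_nonempty x xs phi ys : (forall z w, phi (z :: w) = 0) ->
  weaves (x :: xs) phi ys = 0.
Proof.
move=> phi0; rewrite /=; apply: big1 => i _; rewrite big1 ?scaler0 // => l _.
rewrite (@eq_weaves _ _ (fun _ => 0)) ?weaves_zero ?scaler0 // => w.
by case: (take i ys) => [|z zs]; rewrite phi0.
Qed.

(** The first remaining input of [F] is skipped, receives the first letter of [ys], or receives the
    first letter of [xs] together with a prefix of [ys]. Each case leaves r - 1 inputs, so induction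
    on r applies. *)
Lemma plug_plug r c a F xs ys : sd a F -> a.+1 = (c + r)%N ->
  homog_letters xs -> homog_letters ys ->
  plug (r + shdeg xs) c (plug r c F xs) ys = weaves xs (plug r c F) ys.
Proof.
elim: r c a F xs ys => [|r IH] c a F [|x xs] ys hF e hxs hys;
    rewrite ?plug_nil ?shdeg_nil ?addn0 //.
  by rewrite plug_none plug0 weaves_nonempty // => z w; rewrite plug_none.
move: (hxs) => /homog_letters_cons[hx hxs'].
have {IH} IH F' a' c' xs' ys' : sd a' F' -> a'.+1 = (c' + r)%N ->
  homog_letters xs' -> homog_letters ys' ->
  plug (r + shdeg xs') c' (plug r c' F' xs') ys' = weaves xs' (plug r c' F') ys' by apply: IH.
(* The case where [x] fills input c. [plug_swap] makes [x] the outermost insertion, so that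
   [plug_comp] can distribute [zs]; a second [plug_swap] returns [x] with its prefix to the inside,
   where the induction hypothesis applies. *)
have B zs : homog_letters zs ->
    plug (r.+1 + shdeg (x :: xs)) c ((-1) ^+ (c * x.1) *: plug r (c + x.1).+1 (o c F x.2) xs) zs
  = \sum_(0 <= l < (size zs).+1) (-1) ^+ (shdeg xs * shdeg (take l zs)) *:
     ((-1) ^+ (c * (brace_letter x (take l zs)).1) *:
       weaves xs (plug r (c + (brace_letter x (take l zs)).1).+1
                         (o c F (brace_letter x (take l zs)).2)) (drop l zs)).
  move=> hzs.
  have := @plug_swap r c.+1 c a F x.1 x.2 xs hF _ (ltnSn c) hx hxs'.
  rewrite addSn => /(_ ltac:(lia)) /(congr1 (fun u => (-1) ^+ (x.1 * shdeg xs) *: u)).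
  rewrite scalerA -exprD addnn -[_ ^+ _.*2]signr_odd odd_double scale1r => <-.
  have -> : (r.+1 + shdeg (x :: xs) = x.1.+1 + (r + shdeg xs))%N by rewrite shdeg_cons; lia.
  rewrite !plugZ -[c in plug _ c _ _]addn0.
  rewrite (@plug_comp _ _ _ _ (a + shdeg xs)%N x.1) //; last first.
  - by lia.
  - by apply: sd_plug => //; lia.
  rewrite !scaler_sumr !big_nat; apply: eq_bigr => l lz.
  have hz : sd (brace_letter x (take l zs)).1 (brace_letter x (take l zs)).2.
    by apply: sd_plug => //; apply: homog_letters_take.
  rewrite (@plug_swap r c.+1 c a F _ _ xs hF _ (ltnSn c) hz hxs'); last by lia.
  rewrite plugZ addSn.
  have -> : (c + 0 + x.1.+1 + shdeg (take l zs) = (c + (brace_letter x (take l zs)).1).+1)%N.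
    by rewrite /brace_letter /=; lia.
  rewrite (IH _ (a + (brace_letter x (take l zs)).1)%N) //; last first.
  - exact: homog_letters_drop.
  - by lia.
  - by apply: sd_o => //; lia.
  by rewrite /brace_letter /=; modulo_signs.
rewrite plug_cons plugD B //.
(* [plug_cons] under [weaves]; the empty word fills no input, hence the default 0. *)
have -> : weaves (x :: xs) (plug r.+1 c F) ys
   = weaves (x :: xs) (plug r c.+1 F) ys
     + weaves (x :: xs) (fun w => if w is z :: w' then
          (-1) ^+ (c * z.1) *: plug r (c + z.1).+1 (o c F z.2) w' else 0) ys.
  rewrite -[weaves _ (plug r c.+1 F) ys]scale1r -weaves_linear.
  by apply: eq_weaves => -[|z w]; rewrite scale1r ?plug_nil ?addr0 ?plug_cons.
have wZ k phi zs : weaves xs (fun w => k *: phi w) zs = k *: weaves xs phi zs.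
  have := weaves_linear xs k phi (fun _ => 0) zs; rewrite weaves_zero addr0 => <-.
  by apply: eq_weaves => w; rewrite addr0.
have wZ' k phi zs : weaves (x :: xs) (fun w => k *: phi w) zs = k *: weaves (x :: xs) phi zs.
  have := weaves_linear (x :: xs) k phi (fun _ => 0) zs; rewrite weaves_zero addr0 => <-.
  by apply: eq_weaves => w; rewrite addr0.
case: ys hys => [|y ys] hys.
  rewrite plug_nil -[plug r c.+1 F _](plug_nil (r + shdeg (x :: xs)) c.+1).
  rewrite (IH _ a) //; last by lia.
  congr (_ + _); rewrite weaves_nil_r wZ big_nat1 shdeg_nil muln0 scale1r.
  by rewrite take0 drop0.
move: (hys) => /homog_letters_cons[hy hys'].
rewrite addSn plug_cons (IH _ a) //; last by lia.
rewrite !weaves_cons.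
(* Here [y] fills input c itself. Moving it in front of [x :: xs] produces the sign of the last term
   of [weaves_cons]. *)
rewrite (@plug_swap r c.+1 c a F y.1 y.2 (x :: xs)) //; last by lia.
rewrite plugZ addSn (IH _ (a + y.1)%N) //; last first.
- by lia.
- by apply: sd_o => //; lia.
cbv beta iota; rewrite wZ'.
under [X in _ = _ + (X + _)]eq_bigr => l _ do rewrite wZ.
set A := \sum_(0 <= l < _) _; set B1 := \sum_(0 <= l < _) _.
modulo_signs.
Qed.

Local Notation B x ys := (plug x.1.+1 0 x.2 ys).

Lemma iterated_brace x xs ys : sd x.1 x.2 -> homog_letters xs -> homog_letters ys ->
  B (brace_letter x xs) ys = weaves xs (plug x.1.+1 0 x.2) ys.
Proof. by move=> hx hxs hys; rewrite -(plug_plug (a := x.1)). Qed.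

Lemma brace_letter_nil x : brace_letter x [::] = x.
Proof. by case: x => a F; rewrite /brace_letter plug_nil shdeg_nil addn0. Qed.

Lemma weaves_nil xs phi : weaves xs phi [::] = phi xs.
Proof.
elim: xs phi => // x xs IH phi.
by rewrite weaves_nil_r IH brace_letter_nil.
Qed.

(** A letter left outside the brace of [x] would make the word longer than one, so all of [ys]
    enters it. *)
Lemma weaves_short x phi ys : (forall w, (1 < size w)%N -> phi w = 0) ->
  weaves [:: x] phi ys = phi [:: brace_letter x ys].
Proof.
elim: ys phi => [|y ys IH] phi h; first by rewrite weaves_nil brace_letter_nil.
rewrite weaves_cons IH => [|w]; last by move=> ws; rewrite h //=; lia.
rewrite [phi [:: y; _]]h // scaler0 addr0 big_nat_recr //= take_size drop_size.
rewrite shdeg_nil scale1r big_nat big1 ?add0r // => l ls.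
by rewrite h ?scaler0 //= size_drop /=; lia.
Qed.

Lemma weaves_vanish xs phi ys : (forall w, (size xs <= size w)%N -> phi w = 0) ->
  weaves xs phi ys = 0.
Proof.
elim: xs phi ys => [|x xs IH] phi ys h; first exact: h.
rewrite /=; apply: big1 => i _; rewrite big1 ?scaler0 // => l _.
by rewrite IH ?scaler0 // => w ws; apply: h; rewrite size_cat /=; lia.
Qed.

(** Output words have at least as many letters as [x :: xs]; if no longer ones count, nothing can
    stand in front of [x]. *)
Lemma weaves_head x xs phi ys : (forall w, ((size xs).+1 < size w)%N -> phi w = 0) ->
  weaves (x :: xs) phi ys =
  \sum_(0 <= l < (size ys).+1) (-1) ^+ (shdeg xs * shdeg (take l ys)) *:
    weaves xs (fun w => phi (brace_letter x (take l ys) :: w)) (drop l ys).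
Proof.
case: ys => [|y ys] h; first by rewrite weaves_nil_r big_nat1 shdeg_nil muln0 scale1r.
by rewrite weaves_cons [weaves (x :: xs) _ _]weaves_vanish ?scaler0 ?addr0 // => w ws; apply: h.
Qed.

(** Meant for the binary [pi]: at most one letter stays outside the brace of [x], and since [x]
    takes consecutive letters it is the first or the last one. *)
Lemma weaves_pairs x phi first last init rest : (forall w, (2 < size w)%N -> phi w = 0) ->
  first :: rest = rcons init last ->
  weaves [:: x] phi (first :: rest) = phi [:: brace_letter x (first :: rest)]
   + (-1) ^+ (first.1 * x.1) *: phi [:: first; brace_letter x rest]
   + phi [:: brace_letter x init; last].
Proof.
move=> h e; rewrite weaves_cons weaves_short => [|w]; last by move=> ws; apply: h.
rewrite shdeg_cons shdeg_nil addn0 -addrA [_ *: _ + _]addrC addrA; congr (_ + _).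
rewrite e; have -> : (size rest).+2 = (size init).+2.
  by have := congr1 size e; rewrite size_rcons /= => ->.
rewrite big_nat_recr // big_nat_recr //= !mul0n !expr0 !scale1r.
rewrite big_nat big1 ?add0r => [|l ls]; last first.
  by rewrite h ?scale1r //= size_drop size_rcons; lia.
rewrite addrC -{1 2}(size_rcons init last) take_size drop_size.
by rewrite -cats1 take_size_cat // drop_size_cat.
Qed.

(** A single letter stands between two letters of [xs] or enters one of them; its sign comes from
    the letters of [xs] behind it. *)
Lemma weaves_insert d xs phi y : weaves xs phi [:: y] =
  \sum_(0 <= i < (size xs).+1) (-1) ^+ (y.1 * shdeg (drop i xs)) *:
    phi (take i xs ++ y :: drop i xs)
  + \sum_(0 <= i < size xs) (-1) ^+ (y.1 * shdeg (drop i.+1 xs)) *: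
    phi (take i xs ++ brace_letter (nth d xs i) [:: y] :: drop i.+1 xs).
Proof.
elim: xs phi => [|x xs IH] phi.
  by rewrite big_nat1 big_geq //= shdeg_nil muln0 scale1r addr0.
rewrite weaves_cons big_nat_recl // big_nat1 take0 drop0 [take 1 _]/= [drop 1 _]/=.
rewrite shdeg_nil !muln0 scale1r.
rewrite !weaves_nil IH brace_letter_nil.
rewrite [in RHS]big_nat_recl // [X in _ = _ + X]big_nat_recl //= drop0 !shdegE addn0.
set S1 := \sum_(0 <= i < _) _; set S2 := \sum_(0 <= i < _) _.
by rewrite /S1 [(shdeg xs * y.1)%N]mulnC; modulo_signs.
Qed.

(** * Identities involving the multiplication *)

Variable p : X.
Hypotheses (hp : sd 1 p) (pp : o 0 p p = o 1 p p).
Local Notation pi := (1%N, p).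

Definition diff_val x : X := plug 2 0 p [:: x] - (-1) ^+ x.1 *: B x [:: pi].
(** Since [x.1.+1] is the unshifted degree, this is the product of Gerstenhaber and Voronov. *)
Definition dot_val x y : X := (-1) ^+ x.1.+1 *: plug 2 0 p [:: x; y].
Definition diff_letter x : nat * X := (x.1.+1, diff_val x).
Definition dot_letter x y : nat * X := ((x.1 + y.1).+1, dot_val x y).
Definition bracket_val x y : X := B x [:: y] - (-1) ^+ (x.1 * y.1) *: B y [:: x].
Definition bracket_letter x y : nat * X := ((x.1 + y.1)%N, bracket_val x y).

Lemma hpi : homog_letters [:: pi]. Proof. by apply/homog_letters_cons. Qed.
Lemma homog_letters1 x : sd x.1 x.2 -> homog_letters [:: x].
Proof. by move=> h; apply/homog_letters_cons. Qed.
Lemma homog_letters2 x y : sd x.1 x.2 -> sd y.1 y.2 -> homog_letters [:: x; y].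
Proof. by move=> h1 h2; do 2?[apply/homog_letters_cons; split]. Qed.

(** As [pi] has shifted degree 1, its two insertions into itself carry opposite signs, and [pp]
    makes them cancel. *)
Lemma brace_pi_pi : plug 2 0 p [:: pi] = 0.
Proof. by rewrite !plug_cons !plug_none !plug_nil /= pp; modulo_signs. Qed.

Lemma iterated_brace_pi xs ys n : n = (shdeg xs).+2 -> homog_letters xs -> homog_letters ys ->
  plug n 0 (plug 2 0 p xs) ys = weaves xs (plug 2 0 p) ys.
Proof. by move=> -> hxs hys; rewrite -(plug_plug (a := 1)). Qed.

Lemma brace_pi_over ys : (2 < size ys)%N -> plug 2 0 p ys = 0.
Proof. exact: plug_overfull. Qed.

Lemma brace_pi_letter1 x : brace_letter pi [:: x] = (x.1.+1, plug 2 0 p [:: x]).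
Proof. by rewrite /brace_letter !shdegE addn0. Qed.
Lemma brace_pi_letter2 x y : brace_letter pi [:: x; y] = ((x.1 + y.1).+1, plug 2 0 p [:: x; y]).
Proof. by rewrite /brace_letter !shdegE addn0. Qed.
Lemma brace_letter1 x y : brace_letter x [:: y] = ((x.1 + y.1)%N, B x [:: y]).
Proof. by rewrite /brace_letter !shdegE addn0. Qed.
Lemma brace_letter_pi x : brace_letter x [:: pi] = (x.1.+1, B x [:: pi]).
Proof. by rewrite brace_letter1 addn1. Qed.

(** The letter [z] enters [y] or stands on one side of it. The last two terms are graded symmetric
    in [y] and [z], which makes the commutator a Lie bracket. *)
Lemma pre_lie x y z : sd x.1 x.2 -> sd y.1 y.2 -> sd z.1 z.2 ->
  B (brace_letter x [:: y]) [:: z] = B x [:: brace_letter y [:: z]] + B x [:: y; z]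
    + (-1) ^+ (y.1 * z.1) *: B x [:: z; y].
Proof.
move=> hx hy hz; rewrite iterated_brace //; try exact: homog_letters1.
rewrite (weaves_insert y) !big_nat_recl // !big_geq //=.
by rewrite !shdegE; modulo_signs.
Qed.

Lemma pre_lie_at n m x y z : n = (x.1 + y.1)%N -> m = (y.1 + z.1)%N ->
  sd x.1 x.2 -> sd y.1 y.2 -> sd z.1 z.2 ->
  plug n.+1 0 (B x [:: y]) [:: z] = B x [:: (m, B y [:: z])] + B x [:: y; z]
    + (-1) ^+ (y.1 * z.1) *: B x [:: z; y].
Proof. by move=> -> -> hx hy hz; rewrite -!brace_letter1 -pre_lie // brace_letter1. Qed.

Lemma dot_pi x y : plug 2 0 p [:: x; y] = (-1) ^+ x.1.+1 *: dot_val x y.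
Proof. by rewrite /dot_val scalerA -exprD addnn -signr_odd odd_double scale1r. Qed.

(** Only one pair of positions exists, and in the brace [y] has [x.1.+1] inputs in front of it.
    Combined with the sign of [dot_val] this gives the exponent m n of [operad_dot]. *)
Lemma dotE x y : sd x.1 x.2 -> sd y.1 y.2 ->
  dot_val x y = (-1) ^+ (x.1.+1 * y.1.+1) *: o 0 (o 1 p y.2) x.2.
Proof.
move=> hx hy; rewrite /dot_val /= !plug_cons !plug_none !plug_nil mul0n add0n.
have /= <- := @o_par 1 _ _ 0 1 p _ _ hp hx hy isT isT; rewrite add1n; modulo_signs.
Qed.

Lemma diff_valE x : diff_val x = bracket_val pi x.
Proof. by rewrite /diff_val /bracket_val mul1n. Qed.

Lemma plugN r c F ys : plug r c (- F) ys = - plug r c F ys.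
Proof. by rewrite -scaleN1r plugZ scaleN1r. Qed.
Lemma plugNr r c F us b u ws :
  plug r c F (us ++ (b, - u) :: ws) = - plug r c F (us ++ (b, u) :: ws).
Proof. by rewrite -scaleN1r plugZr scaleN1r. Qed.
Lemma brace1D r c E b F G :
  plug r c E [:: (b, F + G)] = plug r c E [:: (b, F)] + plug r c E [:: (b, G)].
Proof. exact: (plugDr _ _ _ [::]). Qed.
Lemma brace1Z r c E b k F : plug r c E [:: (b, k *: F)] = k *: plug r c E [:: (b, F)].
Proof. exact: (plugZr _ _ _ [::]). Qed.
Lemma brace1N r c E b F : plug r c E [:: (b, - F)] = - plug r c E [:: (b, F)].
Proof. by rewrite -scaleN1r brace1Z scaleN1r. Qed.
Lemma brace2Dl r c E b F G y :
  plug r c E [:: (b, F + G); y] = plug r c E [:: (b, F); y] + plug r c E [:: (b, G); y].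
Proof. exact: (plugDr _ _ _ [::]). Qed.
Lemma brace2Zl r c E b k F y : plug r c E [:: (b, k *: F); y] = k *: plug r c E [:: (b, F); y].
Proof. exact: (plugZr _ _ _ [::]). Qed.
Lemma brace2Nl r c E b F y : plug r c E [:: (b, - F); y] = - plug r c E [:: (b, F); y].
Proof. by rewrite -scaleN1r brace2Zl scaleN1r. Qed.
Lemma brace2Dr r c E b F G y :
  plug r c E [:: y; (b, F + G)] = plug r c E [:: y; (b, F)] + plug r c E [:: y; (b, G)].
Proof. exact: (plugDr _ _ _ [:: y]). Qed.
Lemma brace2Zr r c E b k F y : plug r c E [:: y; (b, k *: F)] = k *: plug r c E [:: y; (b, F)].
Proof. exact: (plugZr _ _ _ [:: y]). Qed.
Lemma brace2Nr r c E b F y : plug r c E [:: y; (b, - F)] = - plug r c E [:: y; (b, F)].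
Proof. by rewrite -scaleN1r brace2Zr scaleN1r. Qed.
Definition brace_linE := (plugD, plugN, plugZ, brace1D, brace1N, brace1Z,
  brace2Dl, brace2Nl, brace2Zl, brace2Dr, brace2Nr, brace2Zr).

(** Six double braces are expanded by the pre-Lie identity; the braces with two letters then cancel
    in pairs. *)
Lemma bracket_val_jacobi x y z : sd x.1 x.2 -> sd y.1 y.2 -> sd z.1 z.2 ->
  bracket_val x (bracket_letter y z) = bracket_val (bracket_letter x y) z
    + (-1) ^+ (x.1 * y.1) *: bracket_val y (bracket_letter x z).
Proof.
move=> hx hy hz; rewrite /bracket_letter /bracket_val /= !brace_linE.
rewrite (pre_lie_at erefl (addnC x.1 z.1) hy hz hx).
rewrite (pre_lie_at (addnC _ _) (addnC x.1 y.1) hz hy hx).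
rewrite (pre_lie_at erefl erefl hx hy hz).
rewrite (pre_lie_at (addnC _ _) erefl hy hx hz).
rewrite (pre_lie_at erefl (addnC y.1 z.1) hx hz hy).
rewrite (pre_lie_at (addnC _ _) erefl hz hx hy).
by modulo_signs.
Qed.

Lemma diff_bracket y z : sd y.1 y.2 -> sd z.1 z.2 ->
  diff_val (bracket_letter y z)
  = bracket_val (diff_letter y) z + (-1) ^+ y.1 *: bracket_val y (diff_letter z).
Proof.
move=> hy hz; rewrite diff_valE bracket_val_jacobi // mul1n /bracket_letter /= -!diff_valE.
by rewrite /diff_letter !add1n.
Qed.

Lemma diff_diff x : sd x.1 x.2 -> diff_val (diff_letter x) = 0.
Proof.
move=> hx; rewrite /diff_val /diff_letter /diff_val /= !brace_linE.
have /= := @pre_lie_at 2 x.1.+1 pi pi x erefl erefl hp hp hx.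
rewrite brace_pi_pi plug0 => e1.
have /= e2 := @pre_lie_at x.1.+1 x.1.+1 pi x pi erefl (esym (addn1 _)) hp hx hp.
(* x{pi}{pi} vanishes: x{pi, pi} occurs twice with opposite signs, and pi{pi} = 0. *)
have /= e3 := @pre_lie_at x.1.+1 2 x pi pi (esym (addn1 _)) erefl hx hp hp.
rewrite e2 e3 brace_pi_pi (plug_zero_r _ _ _ [::]).
have -> : plug 2 0 p [:: (x.1.+1, plug 2 0 p [:: x])] =
    - (plug 2 0 p [:: pi; x] + (-1) ^+ x.1 *: plug 2 0 p [:: x; pi]).
  by apply/eqP; rewrite -addr_eq0 addrA e1 mul1n.
rewrite /= muln1 mul1n; modulo_signs.
Qed.

(** Expand pi{pi}{x, y, z} = 0. The inner [pi] cannot take three letters, so only pi{pi{x, y}, z}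
    and pi{x, pi{y, z}} survive. *)
Lemma dot_val_assoc x y z : sd x.1 x.2 -> sd y.1 y.2 -> sd z.1 z.2 ->
  dot_val (dot_letter x y) z = dot_val x (dot_letter y z).
Proof.
move=> hx hy hz.
have h3 : homog_letters [:: x; y; z] by apply/homog_letters_cons; split=> //; apply: homog_letters2.
have := @iterated_brace_pi [:: pi] [:: x; y; z] 3 _ hpi h3.
rewrite !shdegE => /(_ erefl).
rewrite (@weaves_pairs _ _ x z [:: x; y] [:: y; z]) //; last exact: plug_overfull.
have b3 : brace_letter pi [:: x; y; z] = ((1 + shdeg [:: x; y; z])%N, 0).
  by rewrite /brace_letter brace_pi_over.
rewrite brace_pi_pi plug0 b3 !brace_pi_letter2.
rewrite (plug_zero_r _ _ _ [::]) /dot_val !brace_linE /= add0r muln1 => e.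
have -> : plug 2 0 p [:: ((x.1 + y.1).+1, plug 2 0 p [:: x; y]); z]
    = - ((-1) ^+ x.1 *: plug 2 0 p [:: x; ((y.1 + z.1).+1, plug 2 0 p [:: y; z])]).
  by apply/eqP; rewrite -addr_eq0 addrC -e.
by modulo_signs.
Qed.

(** In pi{x, y}{ys} the inputs of [pi] are taken by [x] and [y], so each letter enters one of them:
    a prefix enters [x] and the rest [y]. *)
Lemma dot_distributive x y ys : sd x.1 x.2 -> sd y.1 y.2 -> homog_letters ys ->
  B (dot_letter x y) ys = \sum_(0 <= l < (size ys).+1)
    (-1) ^+ (y.1.+1 * shdeg (take l ys)) *:
    dot_val (brace_letter x (take l ys)) (brace_letter y (drop l ys)).
Proof.
move=> hx hy hys; rewrite /dot_letter /dot_val /= plugZ.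
rewrite (@iterated_brace_pi [:: x; y]) //; [|by rewrite !shdegE addn0|exact: homog_letters2].
rewrite (@weaves_head _ [:: y]) => [|w]; last exact: brace_pi_over.
rewrite scaler_sumr; apply: eq_bigr => l _.
rewrite weaves_short => [|w ws]; last by rewrite brace_pi_over.
rewrite !shdegE addn0; modulo_signs.
Qed.

(** The three sums correspond to [pi] absorbing no letter, one letter or two neighbouring letters;
    with more letters its brace is zero. *)
Lemma weaves_pi phi d xs : (forall us b ws, phi (us ++ (b, 0) :: ws) = 0) ->
  weaves [:: pi] phi xs =
    \sum_(0 <= i < (size xs).+1) (-1) ^+ shdeg (take i xs) *:
      phi (take i xs ++ pi :: drop i xs)
    + \sum_(0 <= i < size xs) (-1) ^+ shdeg (take i xs) *:
      phi (take i xs ++ brace_letter pi [:: nth d xs i] :: drop i.+1 xs)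
    + \sum_(0 <= i < (size xs).-1) (-1) ^+ shdeg (take i xs) *:
      phi (take i xs ++ brace_letter pi [:: nth d xs i; nth d xs i.+1] :: drop i.+2 xs).
Proof.
elim: xs phi => [|y ys IH] phi h.
  by rewrite weaves_nil big_nat1 !big_geq //= shdeg_nil scale1r !addr0.
rewrite weaves_cons IH => [|us b ws]; last exact: (h (y :: us)).
rewrite big_nat_recl // big_nat_recl // take0 drop0 brace_letter_nil.
rewrite shdeg_nil !mul0n !expr0 !scale1r.
have signE (n : nat) (F : X) : (-1) ^+ (y.1 + n) *: F = (-1) ^+ y.1 *: ((-1) ^+ n *: F).
  by rewrite exprD scalerA.
have -> : (-1) ^+ (y.1 * shdeg [:: pi]) = (-1) ^+ y.1 :> K by rewrite !shdegE addn0 muln1.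
have -> : \sum_(0 <= i < (size (y :: ys)).+1) (-1) ^+ shdeg (take i (y :: ys)) *:
      phi (take i (y :: ys) ++ pi :: drop i (y :: ys)) = phi (pi :: y :: ys)
    + (-1) ^+ y.1 *: \sum_(0 <= i < (size ys).+1) (-1) ^+ shdeg (take i ys) *:
        phi (y :: take i ys ++ pi :: drop i ys).
  rewrite big_nat_recl // take0 drop0 shdeg_nil expr0 scale1r scaler_sumr.
  by congr (_ + _); apply: eq_bigr => i _; rewrite /= shdeg_cons signE.
have -> : \sum_(0 <= i < size (y :: ys)) (-1) ^+ shdeg (take i (y :: ys)) *:
      phi (take i (y :: ys) ++ brace_letter pi [:: nth d (y :: ys) i] :: drop i.+1 (y :: ys))
    = phi (brace_letter pi [:: y] :: ys)
    + (-1) ^+ y.1 *: \sum_(0 <= i < size ys) (-1) ^+ shdeg (take i ys) *: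
        phi (y :: take i ys ++ brace_letter pi [:: nth d ys i] :: drop i.+1 ys).
  rewrite big_nat_recl // take0 shdeg_nil expr0 scale1r scaler_sumr /= drop0.
  by congr (_ + _); apply: eq_bigr => i _; rewrite /= shdeg_cons signE.
have -> : \sum_(0 <= i < (size (y :: ys)).-1) (-1) ^+ shdeg (take i (y :: ys)) *:
      phi (take i (y :: ys) ++ brace_letter pi [:: nth d (y :: ys) i; nth d (y :: ys) i.+1]
        :: drop i.+2 (y :: ys))
    = \sum_(0 <= i < size ys) phi (brace_letter pi (take i.+2 (y :: ys)) :: drop i.+2 (y :: ys))
    + (-1) ^+ y.1 *: \sum_(0 <= i < (size ys).-1) (-1) ^+ shdeg (take i ys) *:
        phi (y :: take i ys ++ brace_letter pi [:: nth d ys i; nth d ys i.+1] :: drop i.+2 ys).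
  case: ys {IH} => [|z ys]; first by rewrite !big_geq // scaler0 addr0.
  rewrite big_nat_recl // [in RHS]big_nat_recl // [X in _ = _ + X + _]big_nat.
  rewrite [X in _ = _ + X + _]big1.
    rewrite addr0 /= shdeg_nil expr0 scale1r take0 scaler_sumr drop0.
    by congr (_ + _); apply: eq_bigr => i _; rewrite shdeg_cons signE.
  move=> i iz; rewrite [X in phi (X :: _)]/brace_letter brace_pi_over ?(h [::]) //=.
  by rewrite size_takel //; lia.
rewrite /= drop0.
under [X in _ + (_ + X) + _]eq_bigr => i _ do rewrite scale1r.
rewrite take0.
set S0 := \sum_(0 <= i < size ys) phi (brace_letter _ _ :: _).
set S1 := \sum_(0 <= i < _.+1) _; set S2 := \sum_(0 <= i < size ys) _.
set S3 := \sum_(0 <= i < _.-1) _.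
by modulo_signs.
Qed.

(** Both d(x{xs}) and (dx){xs} are expanded by the brace identity. The terms pi{x{xs}} and those
    with a bare [pi] between letters cancel. A [pi] with one letter, or inside a letter, gives the
    differentials of the letters; a [pi] with two letters gives their products; the rest of
    pi{x}{xs} gives the two outer products. *)
Lemma brace_homotopy x xs first last init rest :
  sd x.1 x.2 -> homog_letters xs -> xs = first :: rest -> xs = rcons init last ->
  diff_val (brace_letter x xs) - B (diff_letter x) xs
  - (-1) ^+ x.1 *: \sum_(0 <= i < size xs) (-1) ^+ shdeg (take i xs) *:
      B x (take i xs ++ diff_letter (nth first xs i) :: drop i.+1 xs)
  = (-1) ^+ (x.1.+1 * first.1) *: dot_val first (brace_letter x rest)
  - (-1) ^+ x.1 *: \sum_(0 <= i < (size xs).-1) (-1) ^+ shdeg (take i.+1 xs) *: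
      B x (take i xs ++ dot_letter (nth first xs i) (nth first xs i.+1) :: drop i.+2 xs)
  + (-1) ^+ (x.1 + shdeg init) *: dot_val (brace_letter x init) last.
Proof.
move=> hx hxs e1 e2.
have shN i : (i < size xs)%N ->
    shdeg xs = (shdeg (take i xs) + ((nth first xs i).1 + shdeg (drop i.+1 xs)))%N.
  by move=> ixs; rewrite -shdeg_cons -drop_nth // -shdeg_take_drop.
(* [weaves_insert] counts the degrees behind [pi], [weaves_pi] those in front. Factoring out the
   total degree turns the sums into common atoms. *)
have E1 : \sum_(0 <= i < (size xs).+1) (-1) ^+ (1 * shdeg (drop i xs)) *:
      B x (take i xs ++ pi :: drop i xs)
    = (-1) ^+ shdeg xs *: \sum_(0 <= i < (size xs).+1) (-1) ^+ shdeg (take i xs) *: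
      B x (take i xs ++ pi :: drop i xs).
  rewrite scaler_sumr; apply: eq_bigr => i _.
  by rewrite (shdeg_take_drop i xs); modulo_signs.
have E2 : \sum_(0 <= i < size xs) (-1) ^+ (1 * shdeg (drop i.+1 xs)) *:
      B x (take i xs ++ brace_letter (nth first xs i) [:: pi] :: drop i.+1 xs)
    = (-1) ^+ shdeg xs *: \sum_(0 <= i < size xs)
      (-1) ^+ (shdeg (take i xs) + (nth first xs i).1) *:
      B x (take i xs ++ brace_letter (nth first xs i) [:: pi] :: drop i.+1 xs).
  rewrite scaler_sumr !big_nat; apply: eq_bigr => i /andP[_ ixs].
  by rewrite (shN i ixs); modulo_signs.
have E3 : \sum_(0 <= i < size xs) (-1) ^+ shdeg (take i xs) *:
      B x (take i xs ++ diff_letter (nth first xs i) :: drop i.+1 xs)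
    = \sum_(0 <= i < size xs) (-1) ^+ shdeg (take i xs) *:
      B x (take i xs ++ brace_letter pi [:: nth first xs i] :: drop i.+1 xs)
    - \sum_(0 <= i < size xs) (-1) ^+ (shdeg (take i xs) + (nth first xs i).1) *:
      B x (take i xs ++ brace_letter (nth first xs i) [:: pi] :: drop i.+1 xs).
  rewrite -sumrB; apply: eq_bigr => i _.
  rewrite /diff_letter /diff_val.
  rewrite plugDr plugNr plugZr -brace_pi_letter1 -brace_letter_pi; modulo_signs.
have E4 : \sum_(0 <= i < (size xs).-1) (-1) ^+ shdeg (take i.+1 xs) *:
      B x (take i xs ++ dot_letter (nth first xs i) (nth first xs i.+1) :: drop i.+2 xs)
    = - \sum_(0 <= i < (size xs).-1) (-1) ^+ shdeg (take i xs) *: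
      B x (take i xs ++ brace_letter pi [:: nth first xs i; nth first xs i.+1] :: drop i.+2 xs).
  rewrite -sumrN !big_nat; apply: eq_bigr => i /andP[_ ixs].
  have ixs' : (i < size xs)%N by lia.
  rewrite /dot_letter /dot_val plugZr -brace_pi_letter2 (take_nth first ixs') -cats1 !shdegE addn0.
  by modulo_signs.
rewrite E3 E4 [diff_val (brace_letter x xs)]/diff_val iterated_brace //; last exact: hpi.
rewrite (weaves_insert first) E1 E2 /diff_letter /diff_val plugD plugN plugZ.
rewrite (@iterated_brace_pi [:: x]) //; [|by rewrite !shdegE addn0|exact: homog_letters1].
have := @iterated_brace x [:: pi] xs hx hpi hxs; rewrite brace_letter_pi => ->.
rewrite (weaves_pi first) => [|us b ws]; last exact: plug_zero_r.
rewrite [X in weaves [:: x] _ X]e1 (@weaves_pairs _ _ first last init rest) //;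
  [|exact: plug_overfull|by rewrite -e1].
rewrite -e1 [plug 2 0 p [:: first; _]]dot_pi [plug 2 0 p [:: _; last]]dot_pi.
rewrite ![(brace_letter _ _).1]/=.
set S1 := \sum_(0 <= i < _.+1) _.
set S2 := \sum_(0 <= i < _) (-1) ^+ (_ + _) *: _.
set S3 := \sum_(0 <= i < size xs) _.
set S4 := \sum_(0 <= i < _.-1) _.
by modulo_signs.
Qed.

Lemma diff_pi : diff_val pi = 0.
Proof. by rewrite /diff_val brace_pi_pi scaler0 subrr. Qed.

(** Adds k times a known equation, leaving a goal for [modulo_signs]. *)
Lemma eq_lin (k : K) (F G F' G' : X) : F = G -> F' = G' + k *: (F - G) -> F' = G'.
Proof. by move=> -> ->; rewrite subrr scaler0 addr0. Qed.

(** The homotopy relation for pi{x, y}: the differential of [pi] vanishes, and the right-hand side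
    is up to sign the expansion of pi{pi}{x, y} = 0. *)
Lemma diff_dot x y : sd x.1 x.2 -> sd y.1 y.2 ->
  diff_val (dot_letter x y)
  = dot_val (diff_letter x) y + (-1) ^+ x.1.+1 *: dot_val x (diff_letter y).
Proof.
move=> hx hy.
have e1 : plug 3 0 (plug 2 0 p [:: pi]) [:: x; y] = 0 by rewrite brace_pi_pi plug0.
rewrite (@iterated_brace_pi [:: pi]) ?shdegE // in e1; [|exact: hpi|exact: homog_letters2].
rewrite (@weaves_pairs _ _ x y [:: x] [:: y]) // in e1; last exact: plug_overfull.
have := @brace_homotopy pi [:: x; y] x y [:: x] [:: y] hp (homog_letters2 hx hy) erefl erefl.
rewrite [diff_letter pi]/diff_letter diff_pi plug0.
rewrite !big_nat_recl // !big_geq //= !shdeg_cons shdeg_nil.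
rewrite !brace_pi_letter1 !brace_pi_letter2 in e1 *.
rewrite /diff_letter /dot_letter /dot_val /diff_val /= !brace_linE in e1 *.
move=> e; apply: (@eq_lin ((-1) ^+ x.1.+1) _ _ _ _ e).
apply: (@eq_lin ((-1) ^+ x.1) _ _ _ _ e1).
rewrite !addn0 ?mul1n ?muln1. modulo_signs.
Qed.

(** The homotopy relation for one letter; on cocycles x{y} is, up to sign, a primitive of the graded
    commutator. *)
Lemma dot_commutator x y : sd x.1 x.2 -> sd y.1 y.2 ->
  diff_val (brace_letter x [:: y]) - B (diff_letter x) [:: y] - (-1) ^+ x.1 *: B x [:: diff_letter y]
  = (-1) ^+ (x.1.+1 * y.1) *: dot_val y x + (-1) ^+ x.1 *: dot_val x y.
Proof.
move=> hx hy.
have := @brace_homotopy x [:: y] y y [::] [::] hx (homog_letters1 hy) erefl erefl.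
rewrite big_nat1 big_geq //= ?take0 ?drop0 ?shdeg_nil ?expr0 ?scale1r ?scaler0 ?addn0 ?subr0.
by rewrite !brace_letter_nil.
Qed.

Lemma dot_brace1 x y z : sd x.1 x.2 -> sd y.1 y.2 -> sd z.1 z.2 ->
  B (dot_letter y z) [:: x] = dot_val y (brace_letter z [:: x])
    + (-1) ^+ (z.1.+1 * x.1) *: dot_val (brace_letter y [:: x]) z.
Proof.
move=> hx hy hz; rewrite dot_distributive //; last exact: homog_letters1.
rewrite big_nat_recl // big_nat1 /= ?take0 !shdegE ?muln0 ?expr0 ?scale1r !brace_letter_nil.
by rewrite ?addn0.
Qed.

(** The half (yz){x} of the bracket distributes exactly by [dot_brace1]; the half x{yz} does so up
    to the homotopy x{y, z}. *)
Lemma bracket_val_dot x y z : sd x.1 x.2 -> sd y.1 y.2 -> sd z.1 z.2 ->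
  bracket_val x (dot_letter y z) = dot_val (bracket_letter x y) z
    + (-1) ^+ (x.1 * y.1.+1) *: dot_val y (bracket_letter x z)
    - (-1) ^+ (x.1 + y.1) *: (diff_val (brace_letter x [:: y; z]) - B (diff_letter x) [:: y; z]
      - (-1) ^+ x.1 *: (B x [:: diff_letter y; z] + (-1) ^+ y.1 *: B x [:: y; diff_letter z])).
Proof.
move=> hx hy hz.
have := @brace_homotopy x [:: y; z] y z [:: y] [:: z] hx (homog_letters2 hy hz) erefl erefl.
rewrite !big_nat_recl // !big_geq //= !shdeg_cons shdeg_nil => e.
rewrite [bracket_val x _]/bracket_val dot_brace1 //.
rewrite !addr0 !addn0 expr0 scale1r in e.
rewrite e !brace_letter1 /dot_val /bracket_letter /bracket_val /= !brace_linE.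
by rewrite (addnC y.1 x.1) (addnC z.1 x.1); modulo_signs.
Qed.

End Plugging.

(** * The direct product of the components *)

Section TupleSums.
Variables (V : nmodType) (T : finType).

Lemma big_tuple_nil (P : pred (seq T)) (F : seq T -> V) :
  \sum_(t : 0.-tuple T | P t) F t = if P [::] then F [::] else 0.
Proof.
rewrite (eq_bigl (fun _ => P [::])) => [|t]; last by rewrite tuple0.
case: ifP => _; last exact: big_pred0_eq.
by rewrite (big_pred1 [tuple]) // => t /=; apply/esym/eqP; apply: tuple0.
Qed.

(** Predicate and summand take plain sequences, so that an induction on the length meets no
    dependent types. *)
Lemma big_tuple_cons l (P : pred (seq T)) (F : seq T -> V) :
  \sum_(t : l.+1.-tuple T | P t) F t =
  \sum_(x : T) \sum_(t : l.-tuple T | P (x :: t)) F (x :: t).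
Proof.
rewrite pair_big_dep /=.
rewrite (reindex (fun q : T * l.-tuple T => [tuple of q.1 :: q.2])) //=.
exists (fun t : l.+1.-tuple T => (thead t, [tuple of behead t])) => [[x t] _|t _] /=.
  by congr (_, _); apply: val_inj.
by apply: val_inj => /=; rewrite [in RHS](tuple_eta t).
Qed.

End TupleSums.

Lemma big_ord_shift (V : nmodType) c m (F : nat -> V) :
  \sum_(x < m | (c <= x)%N) F x = \sum_(0 <= i < m - c) F (i + c)%N.
Proof.
transitivity (\sum_(0 + c <= x < m) F x); last by rewrite big_addn.
by rewrite big_geq_mkord; apply: eq_bigl.
Qed.

Section Total.
Variables (K : fieldType) (O : nat -> lmodType K).

(** The product of all components, not their direct sum: no finiteness of support has to be
    maintained. *)
Definition total : Type := forall k, O k.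

HB.instance Definition _ := gen_eqMixin total.
HB.instance Definition _ := gen_choiceMixin total.

Definition total_zero : total := fun k => 0.
Definition total_opp (F : total) : total := fun k => - F k.
Definition total_add (F G : total) : total := fun k => F k + G k.
Definition total_scale (c : K) (F : total) : total := fun k => c *: F k.

Lemma totalP (F G : total) : (forall k, F k = G k) -> F = G.
Proof. exact: functional_extensionality_dep. Qed.

Fact total_addA : associative total_add.
Proof. by move=> F G H; apply: totalP => k; apply: addrA. Qed.
Fact total_addC : commutative total_add.
Proof. by move=> F G; apply: totalP => k; apply: addrC. Qed.
Fact total_add0 : left_id total_zero total_add.
Proof. by move=> F; apply: totalP => k; apply: add0r. Qed.
Fact total_addN : left_inverse total_zero total_opp total_add.
Proof. by move=> F; apply: totalP => k; apply: addNr. Qed.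
HB.instance Definition _ :=
  GRing.isZmodule.Build total total_addA total_addC total_add0 total_addN.

Fact total_scaleA a b F : total_scale a (total_scale b F) = total_scale (a * b) F.
Proof. by apply: totalP => k; apply: scalerA. Qed.
Fact total_scale1 : left_id 1 total_scale.
Proof. by move=> F; apply: totalP => k; apply: scale1r. Qed.
Fact total_scaleDr : right_distributive total_scale +%R.
Proof. by move=> c F G; apply: totalP => k; apply: scalerDr. Qed.
Fact total_scaleDl F : {morph total_scale^~ F : a b / a + b}.
Proof. by move=> a b; apply: totalP => k; apply: scalerDl. Qed.
HB.instance Definition _ := GRing.Zmodule_isLmodule.Build K total
  total_scaleA total_scale1 total_scaleDr total_scaleDl.

Definition component k (F : total) : O k := F k.
Fact component_linear k : linear (@component k). Proof. by []. Qed.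
HB.instance Definition _ k :=
  GRing.isLinear.Build K total (O k) _ (@component k) (@component_linear k).

Definition embed n (x : O n) : total := fun k => part k x.
Fact embed_linear n : linear (@embed n).
Proof. by move=> c x y; apply: totalP => k; apply: linearP. Qed.
HB.instance Definition _ n := GRing.isLinear.Build K (O n) total _ (@embed n) (@embed_linear n).

Lemma partE k n (x : O n) : part k x = component k (embed x). Proof. by []. Qed.

Lemma part_id n (x : O n) : part n x = x.
Proof. by rewrite /part (untagE _ _ (erefl : tag (homog _) = n)). Qed.
Lemma part_neq k n (x : O n) : n != k -> part k x = 0.
Proof. by move=> nk; rewrite /part untag_dflt. Qed.
(** The type of [embed x] does not mention n, so transports between equal degrees disappear here. *)
Lemma embed_part k n (x : O n) : n = k -> embed (part k x) = embed x.
Proof. by case: _ /; rewrite part_id. Qed.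
Lemma embed_inj n : injective (@embed n).
Proof. by move=> x y /(congr1 (component n)); rewrite -!partE !part_id. Qed.

End Total.

(** * Operations induced on cohomology *)

Section CohomologyClasses.
Variables (K : fieldType) (C : nat -> lmodType K).
Variable d : forall n, {linear C n -> C n.+1}.

Definition coh_repr n (u : cohomology d n) : cocycle d n :=
  repr (u : Quotient.quot (@is_coboundary K C d n)).

Lemma coh_reprK n (u : cohomology d n) : coclass (coh_repr u) = u.
Proof. exact: (@reprK _ (Quotient.quot (@is_coboundary K C d n))). Qed.

Lemma coclass_eqP n (u v : cocycle d n) :
  coclass u = coclass v <-> boundary d (val u - val v).
Proof.
have -> : val u - val v = val (u - v) by [].
split=> [e|b].
  have /asboolP // : u - v \in @is_coboundary K C d n.
  by rewrite Quotient.idealrBE; apply/eqP.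
apply/eqP; rewrite -[_ == _]Quotient.idealrBE; exact/asboolP.
Qed.

Fact coclass_is_linear n : linear (@coclass K C d n).
Proof.
move=> c u v; rewrite /coclass raddfD; congr (_ + _).
exact/esym/coh_scale_pi.
Qed.
HB.instance Definition _ n := GRing.isLinear.Build K (cocycle d n) (cohomology d n) _
  (@coclass K C d n) (@coclass_is_linear n).

Lemma boundary_add n (x y : C n) : boundary d x -> boundary d y -> boundary d (x + y).
Proof.
case: n x y => [|n] x y /=; first by move=> -> ->; rewrite addr0.
by move=> [u ->] [v ->]; exists (u + v); rewrite linearD.
Qed.

Section InducedOperation.
Variables (deg : nat -> nat -> nat) (op : forall m n, C m -> C n -> C (deg m n)).
Arguments op {m n}.
Hypothesis op_bilinear : forall m n, (0 < m)%N -> (0 < n)%N -> bilinear_op (@op m n).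
Hypothesis op_cocycle : forall m n (x : C m) (y : C n), (0 < m)%N -> (0 < n)%N ->
  d _ x = 0 -> d _ y = 0 -> d _ (op x y) = 0.
Hypothesis op_boundary_l : forall m n (x : C m) (y : C n), (0 < m)%N -> (0 < n)%N ->
  boundary d x -> d _ y = 0 -> boundary d (op x y).
Hypothesis op_boundary_r : forall m n (x : C m) (y : C n), (0 < m)%N -> (0 < n)%N ->
  d _ x = 0 -> boundary d y -> boundary d (op x y).

Lemma cocycleP n (u : cocycle d n) : d _ (val u) = 0.
Proof. exact/eqP/(valP u). Qed.

(** The default 0 makes the operation total; [op] is known to preserve cocycles in positive
    degrees. *)
Definition cocycle_op m n (u : cocycle d m) (v : cocycle d n) : cocycle d (deg m n) :=
  insubd (0 : cocycle d (deg m n)) (op (val u) (val v)).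

Lemma val_cocycle_op m n (u : cocycle d m) (v : cocycle d n) : (0 < m)%N -> (0 < n)%N ->
  val (cocycle_op u v) = op (val u) (val v).
Proof.
move=> m0 n0; rewrite val_insubd; case: ifP => // /negP[].
by apply/eqP/op_cocycle => //; apply: cocycleP.
Qed.

Definition induced_op m n (u : cohomology d m) (v : cohomology d n) :
  cohomology d (deg m n) := coclass (cocycle_op (coh_repr u) (coh_repr v)).

Lemma induced_opE m n (u : cocycle d m) (v : cocycle d n) : (0 < m)%N -> (0 < n)%N ->
  induced_op (coclass u) (coclass v) = coclass (cocycle_op u v).
Proof.
move=> m0 n0; apply/coclass_eqP; rewrite !val_cocycle_op //.
have /coclass_eqP bu := coh_reprK (coclass u).
have /coclass_eqP bv := coh_reprK (coclass v).
move: (coh_repr (coclass u)) (coh_repr (coclass v)) bu bv => u' v' bu bv.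
have [opl opr] := op_bilinear m0 n0.
(* Changing one representative at a time makes each difference an operation on a coboundary and a
   cocycle. *)
have -> : op (val u') (val v') - op (val u) (val v) =
    op (val u' - val u) (val v') + op (val u) (val v' - val v).
  have -> : op (val u' - val u) (val v') = op (val u') (val v') - op (val u) (val v').
    by rewrite addrC -scaleN1r opl scaleN1r addrC.
  have -> : op (val u) (val v' - val v) = op (val u) (val v') - op (val u) (val v).
    by rewrite addrC -scaleN1r opr scaleN1r addrC.
  by rewrite addrA subrK.
apply: boundary_add; first by apply: op_boundary_l => //; apply: cocycleP.
by apply: op_boundary_r => //; apply: cocycleP.
Qed.

Lemma induced_opP : induced_by (d := d) (@op) induced_op.
Proof.
move=> m n f g m0 n0; exists (cocycle_op f g); last exact: induced_opE.
exact: val_cocycle_op.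
Qed.

Lemma induced_op_bilinear m n : (0 < m)%N -> (0 < n)%N -> bilinear_op (@induced_op m n).
Proof.
move=> m0 n0; have [opl opr] := op_bilinear m0 n0.
split=> [y|x] c u v.
  rewrite -[u]coh_reprK -[v]coh_reprK -[y]coh_reprK -linearP /= !induced_opE //.
  rewrite -linearP; congr (coclass _); apply: val_inj.
  by rewrite /= !val_cocycle_op //= opl.
rewrite -[u]coh_reprK -[v]coh_reprK -[x]coh_reprK -linearP /= !induced_opE //.
rewrite -linearP; congr (coclass _); apply: val_inj.
by rewrite /= !val_cocycle_op //= opr.
Qed.

End InducedOperation.

End CohomologyClasses.

(** * Braces of an operad *)

Section TotalOperad.
Variables (K : fieldType) (O : nat -> lmodType K).
Variable comp : forall m n : nat, nat -> O m -> O n -> O (m + n).-1.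
Variable id1 : O 1.
Hypothesis Oop : is_operad comp id1.

Local Notation X := (total O).
Local Notation embed := (@embed K O _).

(* The sum is finite, since the composition of degrees [m] and [n] has degree
   [m + n - 1] and only positive degrees are composed; [c] is the number of
   inputs in front of the one filled. *)
Definition tcomp (c : nat) (F G : X) : X := fun k =>
  \sum_(m < k.+1 | (c < m)%N) part k (comp c.+1 (F m) (G (k.+1 - m)%N)).

Lemma tcomp_linear_l c G : linear (fun F => tcomp c F G).
Proof.
move=> a F F'; apply: totalP => k.
rewrite /tcomp -[RHS]/(a *: tcomp c F G k + tcomp c F' G k) scaler_sumr -big_split.
apply: eq_bigr => m cm /=; rewrite -linearP; congr (part _ _).
by apply: (proj1 (operad_bilinear Oop _ _)); have := ltn_ord m; lia.
Qed.

Lemma tcomp_linear_r c F : linear (tcomp c F).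
Proof.
move=> a G G'; apply: totalP => k.
rewrite /tcomp -[RHS]/(a *: tcomp c F G k + tcomp c F G' k) scaler_sumr -big_split.
apply: eq_bigr => m cm /=; rewrite -linearP; congr (part _ _).
by apply: (proj2 (operad_bilinear Oop _ _)); have := ltn_ord m; lia.
Qed.

Lemma comp0l m n i (g : O n) : (1 <= i <= m)%N -> (0 < n)%N -> comp i (0 : O m) g = 0.
Proof.
move=> im n0; have [h _] := operad_bilinear Oop im n0.
by have := h g (-1) 0 0; rewrite scaler0 addr0 scaleN1r addNr.
Qed.
Lemma comp0r m n i (f : O m) : (1 <= i <= m)%N -> (0 < n)%N -> comp i f (0 : O n) = 0.
Proof.
move=> im n0; have [_ h] := operad_bilinear Oop im n0.
by have := h f (-1) 0 0; rewrite scaler0 addr0 scaleN1r addNr.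
Qed.

Lemma tcomp_embed c m n (f : O m) (g : O n) : (c < m)%N -> (0 < n)%N ->
  tcomp c (embed f) (embed g) = embed (comp c.+1 f g).
Proof.
move=> cm n0; apply: totalP => k; rewrite /tcomp.
have off i : i != m -> embed f i = 0.
  by move=> im; rewrite /embed part_neq // eq_sym.
have [mk|km] := ltnP m k.+1; last first.
  rewrite big1 => [|i ci]; last first.
    by have ik := ltn_ord i; rewrite off ?comp0l ?linear0 //; lia.
  by rewrite /embed part_neq //; lia.
rewrite (bigD1 (Ordinal mk)) //= big1 ?addr0 => [|i /andP[ci im]]; last first.
  by have ik := ltn_ord i; rewrite off // comp0l ?linear0 //; lia.
rewrite {1}/embed part_id.
have [e|ne] := eqVneq n (k.+1 - m)%N.
  rewrite /embed; move: (k.+1 - m)%N e => n' e; case: _ / e; by rewrite part_id.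
have -> : embed g (k.+1 - m)%N = 0 by rewrite /embed part_neq.
rewrite comp0r ?linear0 /embed ?part_neq //; lia.
Qed.

(** The degree n is quantified, with an equation, so that elements of degree such as [(m + n).-1]
    qualify without transport. *)
Definition tdeg (a : nat) (F : X) : Prop :=
  exists n, exists2 x : O n, n = a.+1 & F = embed x.

Lemma tdeg_embed n (x : O n) : (0 < n)%N -> tdeg n.-1 (embed x).
Proof. by move=> n0; exists n, x; rewrite ?prednK. Qed.

Lemma tcomp_graded : graded_composition tcomp tdeg.
Proof.
split.
- exact: tcomp_linear_l.
- exact: tcomp_linear_r.
- by move=> a; exists a.+1, 0; rewrite ?linear0.
- move=> a F G [n [x en ->]] [m [y em ->]].
  exists a.+1, (part a.+1 x + part a.+1 y) => //.
  by rewrite linearD /= !embed_part.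
- move=> a k F [n [x en ->]]; exists n, (k *: x) => //; by rewrite linearZ.
- move=> a b c F G [m [f em ->]] [n [g en ->]] ca.
  exists (m + n).-1, (comp c.+1 f g); first by lia.
  by rewrite tcomp_embed //; lia.
- move=> a b e c j F G H [m [f em ->]] [n [g en ->]] [q [h eq ->]] ca jb.
  rewrite !tcomp_embed; try lia.
  apply: totalP => k; rewrite /embed.
  have -> : (c + j).+1 = (c.+1 + j.+1).-1 by lia.
  by apply: (operad_sequential Oop); lia.
- move=> a b e i j F G H [m [f em ->]] [n [g en ->]] [q [h eq ->]] ij ja.
  rewrite !tcomp_embed; try lia.
  apply: totalP => k; rewrite /embed.
  have -> : (j + b).+1 = (j.+1 + n).-1 by lia.
  by apply: (operad_parallel Oop); lia.
Qed.

Definition letter (h : homogeneous O) : nat * X := ((tag h).-1, embed (tagged h)).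

Local Notation plug := (plug tcomp).
Local Notation weaves := (weaves tcomp).
Local Notation brace_letter := (brace_letter tcomp).
Local Notation homog_letters := (homog_letters tdeg).

Lemma homog_letters_map gs : positive gs -> homog_letters (map letter gs).
Proof.
move=> pos y /mapP[g gin ->]; have /allP/(_ _ gin) := pos.
exact: tdeg_embed.
Qed.

(** * From sums over positions to the recursion *)

Lemma plug_head r c F y ys : plug r c F (y :: ys) =
  \sum_(0 <= i < r) (-1) ^+ ((c + i) * y.1) *:
    plug (r - i.+1) (c + i + y.1).+1 (tcomp (c + i) F y.2) ys.
Proof.
elim: r c F => [|r IH] c F; first by rewrite plug_none big_geq.
rewrite plug_cons IH big_nat_recl // addn0 subSS subn0 addrC; congr (_ + _).
by apply: eq_bigr => i _; rewrite addSnnS subSS.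
Qed.

(* The letters are inserted from the last one to the first, as in [insert]. *)
Definition tinsert F (t : seq nat) (ys : seq (nat * X)) : X :=
  foldr (fun q H => tcomp q.1 H q.2.2) F (zip t ys).

Lemma tinsert_deg F a t ys : tdeg a F -> homog_letters ys -> size t = size ys ->
  all (fun i => i <= a)%N t -> tdeg (a + shdeg ys) (tinsert F t ys).
Proof.
move=> hF; elim: t ys => [|i t IH] [|y ys] //= hys; first by rewrite shdeg_nil addn0.
move: hys => /homog_letters_cons[hy hys] [st] /andP[ia ta].
rewrite /tinsert /= -/(tinsert F t ys) shdeg_cons addnCA addnC.
by apply: (sdeg_comp tcomp_graded) => //; [apply: IH | lia].
Qed.

(** The operad brace inserts the leftmost letter last and [plug] inserts it first; the parallel
    axiom reconciles them by shifting the later positions by the degree of [y]. *)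
Lemma tinsert_swap F a i (y : nat * X) t ys : tdeg a F -> tdeg y.1 y.2 -> homog_letters ys ->
  size t = size ys -> all (fun j => j <= a)%N t -> all (fun j => i < j)%N t ->
  tcomp i (tinsert F t ys) y.2 = tinsert (tcomp i F y.2) (map (addn^~ y.1) t) ys.
Proof.
move=> hF hy; elim: t ys => [|j t IH] [|z ys] //= hys.
move: hys => /homog_letters_cons[hz hys] [st] /andP[ja ta] /andP[ij it].
rewrite /tinsert /= -!/(tinsert _ _ _) -IH //.
have hI := tinsert_deg hF hys st ta.
by rewrite (comp_parallel tcomp_graded hI hy hz) //; lia.
Qed.

Definition degree_sign (t degs : seq nat) : nat :=
  (\sum_(q < size degs) nth 0 degs q * (nth 0 t q + sumn (take q degs)))%N.

Lemma degree_sign_cons i t d ds : size t = size ds ->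
  degree_sign (i :: t) (d :: ds) = (d * i + degree_sign (map (addn^~ d) t) ds)%N.
Proof.
move=> st; rewrite /degree_sign big_ord_recl /= addn0; congr (_ + _)%N.
by apply: eq_bigr => q _; rewrite /= (nth_map 0%N) ?st // addnA.
Qed.

Definition above (c : nat) (t : seq nat) : bool := all (leq c) t && sorted ltn t.

Lemma above_cons c i t : above c (i :: t) = (c <= i)%N && above i.+1 t.
Proof.
rewrite /above /= (path_sortedE ltn_trans).
apply/idP/idP => [/andP[/andP[-> _] /andP[h ->]]|/andP[ci /andP[h ->]]].
  by rewrite andbT.
rewrite ci andbT /=; apply/andP; split; last exact: h.
by apply: sub_all h => j ij; apply: leq_trans ci (ltnW ij).
Qed.

(** Positions range over the m original inputs: s is the shift caused by letters already inserted
    and c the least position still allowed. Choosing the first position x leads to shift [s + y.1]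
    and bound x + 1. *)
Lemma sum_tinsert ys m F a s c : tdeg a F -> homog_letters ys -> a.+1 = (m + s)%N ->
  (c <= m)%N ->
  \sum_(t : (size ys).-tuple 'I_m | above c [seq val i | i <- t])
    (-1) ^+ degree_sign [seq (val i + s)%N | i <- t] [seq y.1 | y <- ys] *:
      tinsert F [seq (val i + s)%N | i <- t] ys
  = plug (m - c) (c + s) F ys.
Proof.
elim: ys F a s c => [|y ys IH] F a s c hF hys e cm.
  etransitivity; first exact: (big_tuple_nil (fun t => above c [seq val i | i <- t])
    (fun t : seq 'I_m => (-1) ^+ degree_sign [seq (val i + s)%N | i <- t] [::] *:
        tinsert F [seq (val i + s)%N | i <- t] [::])).
  by rewrite /= plug_nil /tinsert /degree_sign big_ord0 scale1r.
move: hys => /homog_letters_cons[hy hys].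
etransitivity; first exact: (big_tuple_cons _ (fun t => above c [seq val i | i <- t])
    (fun t : seq 'I_m => (-1) ^+ degree_sign [seq (val i + s)%N | i <- t]
        [seq z.1 | z <- y :: ys] *:
        tinsert F [seq (val i + s)%N | i <- t] (y :: ys))).
transitivity (\sum_(x < m | (c <= x)%N) (-1) ^+ (y.1 * (x + s)) *:
    plug (m - x.+1) (x.+1 + (s + y.1)) (tcomp (x + s) F y.2) ys).
  rewrite [RHS]big_mkcond; apply: eq_bigr => x _ /=.
  case: ifP => [cx|/negbT cx]; last first.
    by rewrite big_pred0 // => t; rewrite above_cons (negPf cx).
  have xm := ltn_ord x.
  rewrite -(IH _ (a + y.1)%N (s + y.1)%N x.+1) //; last 2 first.
  - by apply: (sdeg_comp tcomp_graded) => //; lia.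
  - by lia.
  rewrite scaler_sumr; apply: eq_big => [t|t]; first by rewrite above_cons cx.
  rewrite above_cons => /andP[_ /andP[xt _]].
  have addA : [seq (val i + (s + y.1))%N | i <- t]
      = map (addn^~ y.1) [seq (val i + s)%N | i <- t].
    by rewrite -map_comp; apply: eq_map => i /=; rewrite addnA.
  rewrite addA degree_sign_cons ?size_map ?size_tuple // exprD scalerA; congr (_ *: _).
  rewrite [LHS]/(tcomp _ _ _) -/(tinsert F [seq (val i + s)%N | i <- t] ys).
  apply: (tinsert_swap hF hy hys); first by rewrite size_map size_tuple.
    by apply/allP => _ /mapP[i _ ->]; have := ltn_ord i; lia.
  apply/allP => _ /mapP[i it ->]; have /allP/(_ _ (map_f val it)) := xt.
  by rewrite /=; lia.
rewrite plug_head (big_ord_shift c m (fun x => (-1) ^+ (y.1 * (x + s)) *: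
    plug (m - x.+1) (x.+1 + (s + y.1)) (tcomp (x + s) F y.2) ys)).
apply: eq_bigr => i _.
rewrite [(y.1 * _)%N]mulnC; congr ((-1) ^+ (_ * _) *: _); first by lia.
have -> : (m - (i + c).+1 = m - c - i.+1)%N by lia.
have -> : ((i + c).+1 + (s + y.1) = (c + s + i + y.1).+1)%N by lia.
by have -> : (i + c + s = c + s + i)%N by lia.
Qed.

(** The bound on the tag is proved along with the equation, since [tcomp_embed] requires the
    position to be an input of the partial composite. *)
Lemma insert_embed m (f : O m) t gs : positive gs -> size t = size gs ->
  all (fun i => i < m)%N t ->
  (m <= tag (insert comp (homog f) (zip (map S t) gs)))%N /\
  embed (tagged (insert comp (homog f) (zip (map S t) gs)))
  = tinsert (embed f) t (map letter gs).
Proof.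
elim: t gs => [|i t IH] [|g gs] //= /andP[g0 pos] [st] /andP[im tm].
have [mI eI] := IH gs pos st tm.
split; first by rewrite /=; lia.
by rewrite -tcomp_embed //; [rewrite eI | apply: leq_trans mI].
Qed.

Lemma insert_tag m (f : O m) t gs : positive gs -> size t = size gs ->
  tag (insert comp (homog f) (zip (map S t) gs)) = brace_degree m gs.
Proof.
rewrite /brace_degree; elim: t gs => [|i t IH] [|g gs] //=; rewrite ?big_nil ?addn0 //.
move=> /andP[g0 pos] [st]; rewrite IH // big_cons; lia.
Qed.

Lemma brace_embed m (f : O m) gs : (0 < m)%N -> positive gs ->
  embed (operad_brace comp f gs) = plug m 0 (embed f) (map letter gs).
Proof.
move=> m0 pos; have hgs := homog_letters_map pos.
have hf := tdeg_embed f m0.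
have := @sum_tinsert (map letter gs) m (embed f) m.-1 0 0 hf hgs.
rewrite addn0 subn0 size_map => <- //; last by lia.
rewrite /operad_brace linear_sum; apply: eq_big => [t|t st].
  by rewrite /above all_predT.
rewrite linearZ /=.
have -> : [seq (val i + 0)%N | i <- t] = [seq val i | i <- t].
  by apply: eq_map => i; rewrite addn0.
have -> : [seq y.1 | y <- map letter gs] = [seq (tag g).-1 | g <- gs] by rewrite -map_comp.
rewrite /brace_sign /degree_sign size_map; congr (_ *: _).
have -> : [seq (val i).+1 | i <- t] = map S [seq val i | i <- t] by rewrite -map_comp.
have szt : size [seq val i | i <- t] = size gs by rewrite size_map size_tuple.
rewrite embed_part ?insert_tag //.
apply: (proj2 (@insert_embed _ f _ _ pos szt _)).
by apply/allP => _ /mapP[i _ ->]; apply: ltn_ord.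
Qed.

(** * Sums over nested pairs and the brace algebra *)

Fixpoint weave_letters (cur : nat) (xs : seq (nat * X)) (bs : seq (nat * nat))
    (ys : seq (nat * X)) : seq (nat * X) :=
  match xs, bs with
  | x :: xs', (i, j) :: bs' =>
      drop cur (take i ys)
      ++ brace_letter x (drop i (take j ys)) :: weave_letters j xs' bs' ys
  | _, _ => drop cur ys
  end.

Definition weave_exponent (xs : seq (nat * X)) (bs : seq (nat * nat))
    (ys : seq (nat * X)) : nat :=
  (\sum_(q <- zip xs bs) q.1.1 * shdeg (take q.2.1 ys))%N.

Definition flat_pairs (bs : seq (nat * nat)) : seq nat :=
  flatten [seq [:: b.1; b.2] | b <- bs].

Definition pair_val n (b : 'I_n * 'I_n) : nat * nat := (val b.1, val b.2).

(** [weave_exponent] counts all letters of [ys] in front of each x, while [weaves] on [drop cur ys]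
    misses the first cur of them; these give the sign on the right. *)
Lemma sum_weave xs ys Phi cur : (cur <= size ys)%N ->
  \sum_(t : (size xs).-tuple ('I_(size ys).+1 * 'I_(size ys).+1)
          | path leq cur (flat_pairs (map (@pair_val _) t)))
     (-1) ^+ weave_exponent xs (map (@pair_val _) t) ys *:
       Phi (weave_letters cur xs (map (@pair_val _) t) ys)
  = (-1) ^+ (shdeg xs * shdeg (take cur ys)) *: weaves xs Phi (drop cur ys) :> X.
Proof.
elim: xs Phi cur => [|x xs IH] Phi cur cys.
  etransitivity; first exact: (big_tuple_nil
    (fun t => path leq cur (flat_pairs (map (@pair_val _) t)))
    (fun t : seq ('I_(size ys).+1 * 'I_(size ys).+1) =>
       (-1) ^+ weave_exponent [::] (map (@pair_val _) t) ys *: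
       Phi (weave_letters cur [::] (map (@pair_val _) t) ys))).
  by rewrite /= /weave_exponent big_nil shdeg_nil mul0n.
etransitivity; first exact: (big_tuple_cons _
    (fun t => path leq cur (flat_pairs (map (@pair_val _) t)))
    (fun t : seq ('I_(size ys).+1 * 'I_(size ys).+1) =>
       (-1) ^+ weave_exponent (x :: xs) (map (@pair_val _) t) ys *:
       Phi (weave_letters cur (x :: xs) (map (@pair_val _) t) ys))).
pose G i j := (-1) ^+ (x.1 * shdeg (take i ys)) *: ((-1) ^+ (shdeg xs * shdeg (take j ys)) *:
  weaves xs (fun w => Phi (drop cur (take i ys) ++ brace_letter x (drop i (take j ys)) :: w))
    (drop j ys)).
transitivity (\sum_(b : 'I_(size ys).+1 * 'I_(size ys).+1 | (cur <= b.1)%N && (b.1 <= b.2)%N)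
   G b.1 b.2).
  rewrite [RHS]big_mkcond; apply: eq_bigr => -[i j] _ /=.
  case: ifP => [/andP[ci ij]|/negbT cij]; last first.
    by rewrite big_pred0 // => t; rewrite andbA (negPf cij).
  rewrite /G -IH; last by have := ltn_ord j; lia.
  rewrite scaler_sumr; apply: eq_big => [t|t _]; first by rewrite ci ij.
  by rewrite scalerA /weave_exponent big_cons exprD.
rewrite -(pair_big_dep (fun i : 'I_(size ys).+1 => (cur <= i)%N)
   (fun i j : 'I_(size ys).+1 => (i <= j)%N) (fun i j => G i j)) /=.
rewrite (big_ord_shift cur _ (fun i => \sum_(j < _ | (i <= j)%N) G i j)).
rewrite scaler_sumr size_drop -subSn //; apply: eq_big_nat => i /andP[_ isz].
rewrite (big_ord_shift (i + cur)%N _ (fun j => G (i + cur)%N j)).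
rewrite scalerA scaler_sumr drop_drop size_drop -subSn; last by lia.
have sh_takeD k c : shdeg (take (k + c) ys) = (shdeg (take c ys) + shdeg (take k (drop c ys)))%N.
  by rewrite addnC takeD shdeg_cat.
apply: eq_bigr => l _; rewrite /G !scalerA drop_drop -!take_drop !sh_takeD shdeg_cons.
congr (_ *: _); sign_cases.
Qed.

Lemma positive_take l (ys : seq (homogeneous O)) : positive ys -> positive (take l ys).
Proof. by move=> /allP h; apply/allP => y /mem_take; apply: h. Qed.
Lemma positive_drop l (ys : seq (homogeneous O)) : positive ys -> positive (drop l ys).
Proof. by move=> /allP h; apply/allP => y /mem_drop; apply: h. Qed.
Lemma positive_cat (xs ys : seq (homogeneous O)) :
  positive (xs ++ ys) = positive xs && positive ys.
Proof. exact: all_cat. Qed.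

Lemma shdeg_letters ys : shdeg (map letter ys) = sdeg ys.
Proof. by rewrite /shdeg /sdeg big_map. Qed.

Lemma letter_brace m (x : O m) ys : (0 < m)%N -> positive ys ->
  letter (homog (operad_brace comp x ys)) = brace_letter (letter (homog x)) (map letter ys).
Proof.
move=> m0 pos; rewrite /letter /= brace_embed // /brace_letter /= shdeg_letters prednK //.
by congr (_, _); rewrite /brace_degree /sdeg; lia.
Qed.

Lemma positive_weave cur xs bs ys : positive xs -> positive ys ->
  positive (weave (operad_brace comp) cur xs bs ys).
Proof.
move=> + py; elim: xs cur bs => [|x xs IH] cur bs /= => [_|/andP[x0 px]].
  exact: positive_drop.
case: bs => [|[i j] bs]; first exact: positive_drop.
rewrite positive_cat /= IH // positive_drop ?positive_take //= andbT.
exact: leq_trans x0 (leq_addr _ _).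
Qed.

Lemma map_letter_weave cur xs bs ys : positive xs -> positive ys ->
  map letter (weave (operad_brace comp) cur xs bs ys)
  = weave_letters cur (map letter xs) bs (map letter ys).
Proof.
move=> + py; elim: xs cur bs => [|x xs IH] cur bs /= => [_|/andP[x0 px]].
  by rewrite map_drop.
case: bs => [|[i j] bs]; first by rewrite map_drop.
rewrite map_cat map_drop map_take /= IH // letter_brace //.
  by rewrite map_drop map_take; case: x x0.
by rewrite positive_drop ?positive_take.
Qed.

Lemma operad_brace_algebra : is_brace_algebra (operad_brace comp).
Proof.
split.
- move=> m ys m0 pos c x y; apply: (@embed_inj).
  rewrite linearP /= !brace_embed // linearP; exact: (plug_linear tcomp_graded).
- move=> m n x ys zs c u v m0 n0 py pz k.
  rewrite !partE -linearP; congr (component _ _).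
  have pos w : positive (ys ++ homog (w : O n) :: zs) by rewrite positive_cat py /= n0.
  rewrite !brace_embed // !map_cat /= /letter /= linearP.
  exact: (plug_linear_r tcomp_graded).
- by move=> m x m0 k; rewrite !partE brace_embed // plug_nil.
- move=> m x xs ys m0 px py k.
  have hx := tdeg_embed x m0.
  rewrite !partE brace_embed //; last by rewrite /brace_degree; lia.
  rewrite brace_embed // /brace_degree -/(sdeg xs) -shdeg_letters.
  rewrite (plug_plug tcomp_graded hx) ?prednK //; try exact: homog_letters_map.
  under [RHS]eq_bigr => t nt.
    rewrite partE -linearZ brace_embed // ?positive_weave // map_letter_weave //=.
    over.
  rewrite -linear_sum /=; congr (component _ _).
  have := @sum_weave (map letter xs) (map letter ys) (plug m 0 (embed x)) 0 isT.
  rewrite take0 shdeg_nil muln0 expr0 scale1r drop0 => <-.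
  rewrite !size_map; apply: eq_big => t.
    (* [nested] asks for a sorted list, [sum_weave] at 0 for a path starting at 0; as 0 is least,
       they agree. *)
    rewrite /nested /nat_pairs /flat_pairs.
    by case: (flatten _).
  move=> _; congr ((-1) ^+ _ *: _).
  rewrite /weave_exponent /weave_sign.
  have -> : zip (map letter xs) (map (@pair_val _) t)
     = [seq (letter q.1, q.2) | q <- zip xs (nat_pairs t)].
    by rewrite /nat_pairs; elim: (xs) (val t) => [|a l IH] [|b s] //=; rewrite IH.
  by rewrite big_map; apply: eq_bigr => q _; rewrite /= -map_take shdeg_letters.
Qed.

(** * Operads with multiplication *)

Variable mu : O 2.
Hypothesis mu_mult : is_multiplication comp mu.

Let p : X := embed mu.
Let hp : tdeg 1 p := tdeg_embed mu isT.
Lemma tcomp_mu : tcomp 0 p p = tcomp 1 p p.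
Proof. by rewrite /p !tcomp_embed // mu_mult. Qed.
Let pp := tcomp_mu.

Local Notation diff_val := (diff_val tcomp p).
Local Notation diff_letter := (diff_letter tcomp p).
Local Notation dot_val := (dot_val tcomp p).
Local Notation dot_letter := (dot_letter tcomp p).
Local Notation bracket_val := (bracket_val tcomp).
Local Notation bracket_letter := (bracket_letter tcomp).
Local Notation hl x := (letter (homog x)).

Lemma embed_bullet m n (f : O m) (g : O n) : (0 < n)%N ->
  embed (bullet comp f g) = plug m 0 (embed f) [:: hl g].
Proof.
move=> n0; rewrite /bullet linear_sum plug_head big_add1 /=.
apply: eq_big_nat => i im; rewrite linearZ plug_nil add0n /= tcomp_embed //.
Qed.

Lemma embed_bracket m n (f : O m) (g : O n) : (0 < m)%N -> (0 < n)%N ->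
  embed (operad_bracket comp f g) = bracket_val (hl f) (hl g).
Proof.
move=> m0 n0; rewrite /operad_bracket linearB linearZ /= embed_part; last by lia.
by rewrite !embed_bullet // /bracket_val /= !prednK.
Qed.

Lemma embed_diff n (f : O n) : (0 < n)%N -> embed (operad_diff comp mu f) = diff_val (hl f).
Proof.
move=> n0; rewrite /operad_diff linearB linearZ /= !embed_part; try lia.
by rewrite (embed_bullet mu f) // embed_bullet // /diff_val /= prednK.
Qed.

Lemma embed_dot m n (f : O m) (g : O n) : (0 < m)%N -> (0 < n)%N ->
  embed (operad_dot comp mu f g) = dot_val (hl f) (hl g).
Proof.
move=> m0 n0; rewrite /operad_dot linearZ /= embed_part; last by lia.
rewrite (dotE tcomp_graded hp) ?prednK //=; try exact: tdeg_embed.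
by rewrite /p !tcomp_embed //=; lia.
Qed.

Lemma letter_diff n (f : O n) : (0 < n)%N -> hl (operad_diff comp mu f) = diff_letter (hl f).
Proof. by move=> n0; rewrite /letter /diff_letter /= embed_diff // prednK. Qed.
Lemma letter_dot m n (f : O m) (g : O n) : (0 < m)%N -> (0 < n)%N ->
  hl (operad_dot comp mu f g) = dot_letter (hl f) (hl g).
Proof. by move=> m0 n0; rewrite /letter /dot_letter /= embed_dot //; congr (_, _); lia. Qed.
Lemma letter_bracket m n (f : O m) (g : O n) : (0 < m)%N -> (0 < n)%N ->
  hl (operad_bracket comp f g) = bracket_letter (hl f) (hl g).
Proof. by move=> m0 n0; rewrite /letter /bracket_letter /= embed_bracket //; congr (_, _); lia. Qed.

Lemma operad_dot_associative :
  is_associative_product (fun m n => @operad_dot K O comp mu m n).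
Proof.
split=> [m n m0 n0|m n q x y z m0 n0 q0 k].
  split=> [y|x] c u v; apply: (@embed_inj); rewrite linearP /= !embed_dot //.
    rewrite /dot_val /letter /= linearP (plug_linear_r tcomp_graded _ _ _ [::]).
    modulo_signs.
  rewrite /dot_val /letter /= linearP (plug_linear_r tcomp_graded _ _ _ [:: _]).
  by modulo_signs.
rewrite !partE !embed_dot ?addn_gt0 ?m0 ?n0 // !letter_dot //.
by rewrite (dot_val_assoc tcomp_graded hp pp) //; apply: tdeg_embed.
Qed.

Lemma operad_diff_is_linear n : (0 < n)%N -> linear (@operad_diff K O comp mu n).
Proof.
move=> n0 c x y; apply: (@embed_inj); rewrite linearP /= !embed_diff // /diff_val /letter /=.
rewrite linearP (plug_linear_r tcomp_graded _ _ _ [::]) (plug_linear tcomp_graded).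
by modulo_signs.
Qed.

Lemma operad_diff_differential : is_differential (fun n => @operad_diff K O comp mu n).
Proof.
split=> [n n0|n x n0]; first exact: operad_diff_is_linear.
apply: (@embed_inj); rewrite embed_diff // letter_diff // linear0.
by apply: (diff_diff tcomp_graded hp pp); apply: tdeg_embed.
Qed.

Lemma operad_dg : is_dg_associative (fun m n => @operad_dot K O comp mu m n)
  (fun n => @operad_diff K O comp mu n).
Proof.
split; [exact: operad_dot_associative|exact: operad_diff_differential|].
move=> m n x y m0 n0 k; rewrite !partE -linearZ -linearD; congr (component k _).
rewrite embed_diff ?addn_gt0 ?m0 // letter_dot // !embed_dot // !letter_diff //.
by rewrite (diff_dot tcomp_graded hp pp) /= ?prednK //; apply: tdeg_embed.
Qed.

Lemma operad_homotopy_G : is_homotopy_G_algebra (operad_brace comp)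
  (fun m n => @operad_dot K O comp mu m n) (fun n => @operad_diff K O comp mu n).
Proof.
split; [exact: operad_dg|exact: operad_brace_algebra| |].
- move=> m1 m2 x1 x2 ys m10 m20 py k.
  under [RHS]eq_bigr => l _.
    rewrite partE -linearZ embed_dot; first last.
    - by rewrite /brace_degree; lia.
    - by rewrite /brace_degree; lia.
    rewrite !letter_brace ?positive_take ?positive_drop // map_take map_drop.
    over.
  rewrite -linear_sum partE; congr (component k _).
  rewrite brace_embed ?addn_gt0 ?m10 // embed_dot //.
  have -> : (m1 + m2)%N = (m1.-1 + m2.-1).+2 by lia.
  have := @dot_distributive _ _ _ _ tcomp_graded p hp (hl x1) (hl x2) (map letter ys)
    (tdeg_embed x1 m10) (tdeg_embed x2 m20) (homog_letters_map py).
  rewrite [in X in X = _]/dot_letter => ->.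
  rewrite size_map; apply: eq_bigr => l _.
  by rewrite /= prednK // -map_take shdeg_letters.
- move=> m x xs first last init rest m0 px e1 e2 D M nth_x k.
  have hx := tdeg_embed x m0.
  have pos i : (i < size xs)%N -> (0 < tag (nth_x i))%N.
    by move=> ixs; apply: (allP px); apply: mem_nth.
  have nthE i : (i < size xs)%N -> nth (letter first) (map letter xs) i = letter (nth_x i).
    by move=> ixs; rewrite (nth_map first).
  have hatE y : (0 < tag y)%N -> letter y = hl (tagged y) by case: y.
  have := @brace_homotopy _ _ _ _ tcomp_graded p hp (hl x)
    (map letter xs) (letter first) (letter last) (map letter init) (map letter rest) hx
    (homog_letters_map px) (congr1 (map letter) e1).
  have -> : map letter xs = rcons (map letter init) (letter last) by rewrite e2 map_rcons.
  rewrite -map_rcons -e2 => /(_ erefl); set ys := map letter xs => H.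
  have pf : (0 < tag first)%N by move: px; rewrite e1 => /andP[].
  have pr : positive rest by move: px; rewrite e1 => /andP[].
  have pl : (0 < tag last)%N.
    by move: px; rewrite e2 -cats1 positive_cat /= => /and3P[].
  have pin : positive init by move: px; rewrite e2 -cats1 positive_cat => /andP[].
  have b0 gs : (0 < brace_degree m gs)%N by rewrite /brace_degree; lia.
  have -> : part k (operad_diff comp mu (operad_brace comp x xs))
      = component k (diff_val (brace_letter (hl x) ys)).
    by rewrite partE embed_diff // letter_brace.
  have -> : part k (operad_brace comp (operad_diff comp mu x) xs)
      = component k (plug (diff_letter (hl x)).1.+1 0 (diff_letter (hl x)).2 ys).
    by rewrite partE brace_embed // embed_diff //= prednK.
  have -> : part k (operad_dot comp mu (tagged first) (operad_brace comp x rest))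
      = component k (dot_val (letter first) (brace_letter (hl x) (map letter rest))).
    by rewrite partE embed_dot // letter_brace // -hatE.
  have -> : part k (operad_dot comp mu (operad_brace comp x init) (tagged last))
      = component k (dot_val (brace_letter (hl x) (map letter init)) (letter last)).
    by rewrite partE embed_dot // letter_brace // -hatE.
  have -> : \sum_(0 <= i < size xs) (-1) ^+ (sdeg (take i xs)) *:
      part k (operad_brace comp x (take i xs ++ D (nth_x i) :: drop i.+1 xs))
    = component k (\sum_(0 <= i < size ys) (-1) ^+ shdeg (take i ys) *:
      plug (hl x).1.+1 0 (hl x).2
        (take i ys ++ diff_letter (nth (letter first) ys i) :: drop i.+1 ys)).
    rewrite linear_sum size_map; apply: eq_big_nat => i /andP[_ ixs].
    rewrite linearZ -map_take shdeg_letters partE brace_embed //; last first.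
      by rewrite positive_cat positive_take //= positive_drop.
    rewrite map_cat /= map_take map_drop nthE // prednK //.
    by rewrite [letter (D _)]letter_diff ?pos // -hatE ?pos.
  have -> : \sum_(0 <= i < (size xs).-1) (-1) ^+ (sdeg (take i.+1 xs)) *:
      part k (operad_brace comp x
        (take i xs ++ M (nth_x i) (nth_x i.+1) :: drop i.+2 xs))
    = component k (\sum_(0 <= i < (size ys).-1) (-1) ^+ shdeg (take i.+1 ys) *:
      plug (hl x).1.+1 0 (hl x).2
        (take i ys ++ dot_letter (nth (letter first) ys i) (nth (letter first) ys i.+1)
          :: drop i.+2 ys)).
    rewrite linear_sum size_map; apply: eq_big_nat => i /andP[_ ixs].
    have i1 : (i.+1 < size xs)%N by lia.
    have i0 : (i < size xs)%N by lia.
    rewrite linearZ -map_take shdeg_letters partE brace_embed //; last first.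
      by rewrite positive_cat positive_take //= positive_drop // addn_gt0 pos.
    rewrite map_cat /= map_take map_drop !nthE // prednK //.
    by rewrite [letter (M _ _)]letter_dot ?pos // -!hatE ?pos.
  rewrite -shdeg_letters.
  have -> : (m * (tag first).-1 = (hl x).1.+1 * (letter first).1)%N by rewrite /= prednK.
  (* Once the large terms are variables, the goal is the component of [H] by conversion. *)
  move: H; move: (diff_val (brace_letter (hl x) ys)) (plug (diff_letter (hl x)).1.+1 0 _ _)
    (\sum_(0 <= i < size ys) _) (dot_val (letter first) _)
    (\sum_(0 <= i < (size ys).-1) _) (dot_val _ (letter last)) => F1 F2 F3 F4 F5 F6 H.
  exact: (congr1 (component k) H).
Qed.

(** * The Gerstenhaber algebra on cohomology *)

Variable d : forall n, {linear O n -> O n.+1}.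
Hypothesis dE : forall n (x : O n), d n x = operad_diff comp mu x.
Hypothesis O0 : forall x : O 0, x = 0.

Lemma embed_d n (x : O n) : (0 < n)%N -> embed (d n x) = diff_val (hl x).
Proof. by move=> n0; rewrite dE embed_diff. Qed.

Lemma diff_letter_cocycle n (x : O n) : (0 < n)%N -> d n x = 0 -> diff_letter (hl x) = (n, 0).
Proof. by move=> n0 dx; rewrite /diff_letter -embed_d // dx linear0 /= prednK. Qed.

Lemma letter_d n (x : O n) : (0 < n)%N -> hl (d n x) = diff_letter (hl x).
Proof. by move=> n0; rewrite dE letter_diff. Qed.

Lemma boundary_embed m n (y : O m) (z : O n) : m.+1 = n -> embed z = embed (d m y) ->
  boundary d z.
Proof. by move=> e; move: z; case: _ / e => z /embed_inj ->; exists y. Qed.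

Lemma boundary_zero n (z : O n) : z = 0 -> boundary d z.
Proof. by case: n z => [|n] z -> //=; exists 0; rewrite linear0. Qed.

(** A coboundary of degree 1 comes from [O 0], hence is zero; any other has a primitive of positive
    degree, to which the identities apply. *)
Lemma boundaryE n (x : O n) : (0 < n)%N -> boundary d x ->
  x = 0 \/ exists m (y : O m), [/\ (0 < m)%N, n = m.+1 & embed x = embed (d m y)].
Proof.
case: n x => [|[|n]] x // _ [y ->]; last by right; exists n.+1, y.
by left; rewrite (O0 y) linear0.
Qed.

Lemma dot_val0l a y : dot_val (a, 0) y = 0.
Proof. by rewrite /dot_val (plug_zero_r tcomp_graded _ _ _ [::]) scaler0. Qed.
Lemma dot_val0r a x : dot_val x (a, 0) = 0.
Proof. by rewrite /dot_val (plug_zero_r tcomp_graded _ _ _ [:: x]) scaler0. Qed.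
Lemma bracket_val0l a y : bracket_val (a, 0) y = 0.
Proof.
rewrite /bracket_val (plug_zero_r tcomp_graded _ _ _ [::]) (plug0 tcomp_graded).
by rewrite scaler0 subr0.
Qed.
Lemma bracket_val0r a x : bracket_val x (a, 0) = 0.
Proof.
rewrite /bracket_val (plug_zero_r tcomp_graded _ _ _ [::]) (plug0 tcomp_graded).
by rewrite scaler0 subr0.
Qed.

Let dot m n (x : O m) (y : O n) := operad_dot comp mu x y.
Let br m n (x : O m) (y : O n) := operad_bracket comp x y.

Lemma letterE n (x : O n) : hl x = (n.-1, embed x). Proof. by []. Qed.

Lemma dot_zero_l m n (x : O m) (y : O n) : (0 < m)%N -> (0 < n)%N -> x = 0 -> dot x y = 0.
Proof.
move=> m0 n0 ->; apply: (@embed_inj).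
by rewrite /dot embed_dot // letterE !linear0 dot_val0l.
Qed.
Lemma dot_zero_r m n (x : O m) (y : O n) : (0 < m)%N -> (0 < n)%N -> y = 0 -> dot x y = 0.
Proof.
move=> m0 n0 ->; apply: (@embed_inj).
by rewrite /dot embed_dot // [hl 0]letterE !linear0 dot_val0r.
Qed.
Lemma br_zero_l m n (x : O m) (y : O n) : (0 < m)%N -> (0 < n)%N -> x = 0 -> br x y = 0.
Proof.
move=> m0 n0 ->; apply: (@embed_inj).
by rewrite /br embed_bracket // letterE !linear0 bracket_val0l.
Qed.
Lemma br_zero_r m n (x : O m) (y : O n) : (0 < m)%N -> (0 < n)%N -> y = 0 -> br x y = 0.
Proof.
move=> m0 n0 ->; apply: (@embed_inj).
by rewrite /br embed_bracket // [hl 0]letterE !linear0 bracket_val0r.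
Qed.

Lemma embed_d_dot m n (x : O m) (y : O n) : (0 < m)%N -> (0 < n)%N ->
  embed (d _ (dot x y))
  = dot_val (diff_letter (hl x)) (hl y) + (-1) ^+ m *: dot_val (hl x) (diff_letter (hl y)).
Proof.
move=> m0 n0; rewrite embed_d ?addn_gt0 ?m0 // letter_dot //.
by rewrite (diff_dot tcomp_graded hp pp) /= ?prednK //; apply: tdeg_embed.
Qed.

Lemma embed_d_br m n (x : O m) (y : O n) : (0 < m)%N -> (0 < n)%N ->
  embed (d _ (br x y))
  = bracket_val (diff_letter (hl x)) (hl y)
    + (-1) ^+ m.-1 *: bracket_val (hl x) (diff_letter (hl y)).
Proof.
move=> m0 n0; rewrite embed_d; last by lia.
rewrite letter_bracket // (diff_bracket tcomp_graded hp) //; exact: tdeg_embed.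
Qed.

Lemma dot_cocycle m n (x : O m) (y : O n) : (0 < m)%N -> (0 < n)%N ->
  d _ x = 0 -> d _ y = 0 -> d _ (dot x y) = 0.
Proof.
move=> m0 n0 dx dy; apply: (@embed_inj); rewrite embed_d_dot // !diff_letter_cocycle //.
by rewrite dot_val0l dot_val0r scaler0 addr0 linear0.
Qed.

Lemma br_cocycle m n (x : O m) (y : O n) : (0 < m)%N -> (0 < n)%N ->
  d _ x = 0 -> d _ y = 0 -> d _ (br x y) = 0.
Proof.
move=> m0 n0 dx dy; apply: (@embed_inj); rewrite embed_d_br // !diff_letter_cocycle //.
by rewrite bracket_val0l bracket_val0r scaler0 addr0 linear0.
Qed.

Lemma dot_boundary_l m n (x : O m) (y : O n) : (0 < m)%N -> (0 < n)%N ->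
  boundary d x -> d _ y = 0 -> boundary d (dot x y).
Proof.
move=> m0 n0 bx dy; have [x0|[q [z [q0 em ex]]]] := boundaryE m0 bx.
  exact/boundary_zero/dot_zero_l.
apply: (@boundary_embed _ _ (dot z y)); first by lia.
rewrite embed_d_dot // [diff_letter (hl y)]diff_letter_cocycle //.
rewrite dot_val0r scaler0 addr0 embed_dot //.
by rewrite -letter_d // !letterE ex em.
Qed.

Lemma dot_boundary_r m n (x : O m) (y : O n) : (0 < m)%N -> (0 < n)%N ->
  d _ x = 0 -> boundary d y -> boundary d (dot x y).
Proof.
move=> m0 n0 dx b_y; have [y0|[q [z [q0 em ey]]]] := boundaryE n0 b_y.
  exact/boundary_zero/dot_zero_r.
(* For a cocycle [x], the Leibniz rule puts (-1)^m on the product of [x] and dz. *)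
apply: (@boundary_embed _ _ ((-1) ^+ m *: dot x z)); first by lia.
rewrite [d _ _]linearZ [embed (_ *: d _ _)]linearZ /= embed_d_dot //.
rewrite [diff_letter (hl x)]diff_letter_cocycle // dot_val0l add0r embed_dot //.
by rewrite -letter_d // !letterE ey em scalerA -exprD addnn -signr_odd odd_double scale1r.
Qed.

Lemma br_boundary_l m n (x : O m) (y : O n) : (0 < m)%N -> (0 < n)%N ->
  boundary d x -> d _ y = 0 -> boundary d (br x y).
Proof.
move=> m0 n0 bx dy; have [x0|[q [z [q0 em ex]]]] := boundaryE m0 bx.
  exact/boundary_zero/br_zero_l.
apply: (@boundary_embed _ _ (br z y)); first by lia.
rewrite embed_d_br // [diff_letter (hl y)]diff_letter_cocycle //.
rewrite bracket_val0r scaler0 addr0 embed_bracket //.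
by rewrite -letter_d // !letterE ex em.
Qed.

Lemma br_boundary_r m n (x : O m) (y : O n) : (0 < m)%N -> (0 < n)%N ->
  d _ x = 0 -> boundary d y -> boundary d (br x y).
Proof.
move=> m0 n0 dx b_y; have [y0|[q [z [q0 em ey]]]] := boundaryE n0 b_y.
  exact/boundary_zero/br_zero_r.
apply: (@boundary_embed _ _ ((-1) ^+ m.-1 *: br x z)); first by lia.
rewrite [d _ _]linearZ [embed (_ *: d _ _)]linearZ /= embed_d_br //.
rewrite [diff_letter (hl x)]diff_letter_cocycle // bracket_val0l add0r embed_bracket //.
by rewrite -letter_d // !letterE ey em scalerA -exprD addnn -signr_odd odd_double scale1r.
Qed.

Lemma dot_bilinear_op m n : (0 < m)%N -> (0 < n)%N -> bilinear_op (@dot m n).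
Proof. exact: (dot_bilinear operad_dot_associative). Qed.

Lemma br_bilinear_op m n : (0 < m)%N -> (0 < n)%N -> bilinear_op (@br m n).
Proof.
move=> m0 n0; split=> [y|x] c u v; apply: (@embed_inj);
  rewrite /br linearP /= !embed_bracket // /bracket_val /letter /= !linearP
    (plug_linear_r tcomp_graded _ _ _ [::]) (plug_linear tcomp_graded); modulo_signs.
Qed.

Local Notation mulH := (induced_op (d := d) dot).
Local Notation brH := (induced_op (d := d) br).

Lemma mulHE m n (u : cocycle d m) (v : cocycle d n) : (0 < m)%N -> (0 < n)%N ->
  mulH (coclass u) (coclass v) = coclass (cocycle_op (d := d) dot u v).
Proof.
exact: (induced_opE dot_bilinear_op dot_cocycle dot_boundary_l dot_boundary_r).
Qed.
Lemma brHE m n (u : cocycle d m) (v : cocycle d n) : (0 < m)%N -> (0 < n)%N ->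
  brH (coclass u) (coclass v) = coclass (cocycle_op (d := d) br u v).
Proof.
exact: (induced_opE br_bilinear_op br_cocycle br_boundary_l br_boundary_r).
Qed.
Lemma val_mul m n (u : cocycle d m) (v : cocycle d n) : (0 < m)%N -> (0 < n)%N ->
  val (cocycle_op (d := d) dot u v) = dot (val u) (val v).
Proof. exact: (val_cocycle_op dot_cocycle). Qed.
Lemma val_br m n (u : cocycle d m) (v : cocycle d n) : (0 < m)%N -> (0 < n)%N ->
  val (cocycle_op (d := d) br u v) = br (val u) (val v).
Proof. exact: (val_cocycle_op br_cocycle). Qed.

(** Classes whose degrees are only provably equal are related through representatives in the total
    module, with [y] as primitive of the defect. *)
Lemma part_coclass3 n1 n2 n3 m (u : cocycle d n1) (v : cocycle d n2) (w : cocycle d n3)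
    c c' (y : O m) : n1 = n2 -> n1 = n3 -> m.+1 = n1 ->
  embed (val u) = c *: embed (val v) + c' *: embed (val w) + embed (d m y) ->
  forall k, part k (coclass u) = c *: part k (coclass v) + c' *: part k (coclass w).
Proof.
move=> e2 e3 e1; move: v w; case: _ / e2; case: _ / e3; move: u; case: _ / e1.
move=> u v w e k.
rewrite -!linearZ -linearD; congr (part k _).
rewrite /= -linearD; apply/coclass_eqP; exists y; apply: (@embed_inj).
rewrite [LHS]linearB; apply/eqP; rewrite subr_eq; apply/eqP; apply: etrans e _.
rewrite addrC; congr (_ + _).
have -> : \val (c *: v + c' *: w) = c *: \val v + c' *: \val w by [].
by rewrite [RHS]linearD; congr (_ + _); rewrite linearZ.
Qed.

Lemma part_coclass2 n1 n2 m (u : cocycle d n1) (v : cocycle d n2) c (y : O m) :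
  n1 = n2 -> m.+1 = n1 -> embed (val u) = c *: embed (val v) + embed (d m y) ->
  forall k, part k (coclass u) = c *: part k (coclass v).
Proof.
move=> e2 e1 e k.
rewrite (@part_coclass3 _ _ _ _ u v v c 0 y) ?scale0r ?addr0 //.
Qed.

Lemma embed_d_brace m (x : O m) ys : (0 < m)%N -> positive ys ->
  embed (d _ (operad_brace comp x ys)) = diff_val (brace_letter (hl x) (map letter ys)).
Proof.
move=> m0 py; rewrite embed_d ?letter_brace //.
by rewrite /brace_degree; lia.
Qed.

Lemma mulH_assoc m n q (x : cohomology d m) (y : cohomology d n) (z : cohomology d q) :
  (0 < m)%N -> (0 < n)%N -> (0 < q)%N ->
  forall k, part k (mulH (mulH x y) z) = part k (mulH x (mulH y z)).
Proof.
rewrite -[x]coh_reprK -[y]coh_reprK -[z]coh_reprK.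
move: (coh_repr x) (coh_repr y) (coh_repr z) => {x y z} u v w m0 n0 q0 k.
rewrite !mulHE ?addn_gt0 ?m0 ?n0 // -[RHS]scale1r.
(* The primitive is 0 because associativity holds on cochains. *)
apply: (@part_coclass2 _ _ (m + n + q).-1 _ _ _ 0); [by lia|by lia|].
rewrite !val_mul ?addn_gt0 ?m0 ?n0 // scale1r !linear0 addr0.
by apply: totalP => k'; apply: (dot_assoc operad_dot_associative).
Qed.

Lemma mulH_comm m n (x : cohomology d m) (y : cohomology d n) :
  (0 < m)%N -> (0 < n)%N ->
  forall k, part k (mulH x y) = (-1) ^+ (m * n) *: part k (mulH y x).
Proof.
rewrite -[x]coh_reprK -[y]coh_reprK.
move: (coh_repr x) (coh_repr y) => {x y} u v m0 n0 k; rewrite !mulHE //.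
(* By [dot_commutator], x{y} up to sign is the primitive. *)
apply: (@part_coclass2 _ _ _ _ _ _
  ((-1) ^+ m.-1 *: operad_brace comp (val u) [:: homog (val v)])); first by lia.
  by rewrite /brace_degree big_cons big_nil /=; lia.
rewrite !val_mul // [d _ _]linearZ
  [embed (_ *: d _ _)]linearZ /= embed_d_brace //=; last by rewrite n0.
rewrite /dot !embed_dot //.
have := @dot_commutator _ _ _ _ tcomp_graded p hp (hl (val u)) (hl (val v))
  (tdeg_embed _ m0) (tdeg_embed _ n0).
rewrite !diff_letter_cocycle ?(cocycleP u) ?(cocycleP v) // (plug0 tcomp_graded).
rewrite (plug_zero_r tcomp_graded _ _ _ [::]) => e.
apply: (eq_lin (k := (-1) ^+ m.-1) (esym e)) => /=.
have -> : (m * n = m.-1.+1 * n.-1.+1)%N by rewrite !prednK.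
by modulo_signs.
Qed.

Lemma brH_antisym m n (x : cohomology d m) (y : cohomology d n) :
  (0 < m)%N -> (0 < n)%N ->
  forall k, part k (brH x y) = - ((-1) ^+ (m.-1 * n.-1) *: part k (brH y x)).
Proof.
rewrite -[x]coh_reprK -[y]coh_reprK.
move: (coh_repr x) (coh_repr y) => {x y} u v m0 n0 k; rewrite !brHE // -scaleNr.
apply: (@part_coclass2 _ _ (m + n).-2 _ _ _ 0); [by lia|by lia|].
rewrite !val_br // !linear0 addr0 /br !embed_bracket // /bracket_val /=.
by modulo_signs.
Qed.

Lemma brH_jacobi m n q (x : cohomology d m) (y : cohomology d n) (z : cohomology d q) :
  (0 < m)%N -> (0 < n)%N -> (0 < q)%N ->
  forall k, part k (brH x (brH y z)) = part k (brH (brH x y) z)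
    + (-1) ^+ (m.-1 * n.-1) *: part k (brH y (brH x z)).
Proof.
rewrite -[x]coh_reprK -[y]coh_reprK -[z]coh_reprK.
move: (coh_repr x) (coh_repr y) (coh_repr z) => {x y z} u v w m0 n0 q0 k.
have mn0 : (0 < (m + n).-1)%N by lia.
have nq0 : (0 < (n + q).-1)%N by lia.
have mq0 : (0 < (m + q).-1)%N by lia.
rewrite !brHE // -[part k (coclass (cocycle_op _ (cocycle_op _ u v) w))]scale1r.
apply: (@part_coclass3 _ _ _ (m + (n + q).-1).-2 _ _ _ _ _ 0); [by lia|by lia|by lia|].
rewrite !val_br // scale1r !linear0 addr0 /br !embed_bracket // !letter_bracket //.
by rewrite (bracket_val_jacobi tcomp_graded) //; apply: tdeg_embed.
Qed.

Lemma brH_leibniz m n q (x : cohomology d m) (y : cohomology d n) (z : cohomology d q) :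
  (0 < m)%N -> (0 < n)%N -> (0 < q)%N ->
  forall k, part k (brH x (mulH y z)) = part k (mulH (brH x y) z)
    + (-1) ^+ (m.-1 * n) *: part k (mulH y (brH x z)).
Proof.
rewrite -[x]coh_reprK -[y]coh_reprK -[z]coh_reprK.
move: (coh_repr x) (coh_repr y) (coh_repr z) => {x y z} u v w m0 n0 q0 k.
have mn0 : (0 < (m + n).-1)%N by lia.
have nq0 : (0 < n + q)%N by lia.
have mq0 : (0 < (m + q).-1)%N by lia.
rewrite (mulHE v w) // (brHE u v) // (brHE u w) // (brHE u (cocycle_op _ v w)) //.
rewrite (mulHE (cocycle_op _ u v) w) // (mulHE v (cocycle_op _ u w)) //.
rewrite -[part k (coclass (cocycle_op _ (cocycle_op _ u v) w))]scale1r.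
(* The primitive and its sign are read off [bracket_val_dot]. *)
apply: (@part_coclass3 _ _ _ _ _ _ _ _ _ (- (-1) ^+ (m.-1 + n.-1) *:
  operad_brace comp (val u) [:: homog (val v); homog (val w)])); [by lia|by lia| |].
  by rewrite /brace_degree !big_cons big_nil /=; lia.
rewrite !(val_br, val_mul) // [d _ _]linearZ [embed (_ *: d _ _)]linearZ /= embed_d_brace //=;
  last by rewrite n0 q0.
rewrite /br /dot embed_bracket // !embed_dot // letter_dot // !letter_bracket //.
rewrite (bracket_val_dot tcomp_graded hp) //; try exact: tdeg_embed.
rewrite !diff_letter_cocycle ?(cocycleP u) ?(cocycleP v) ?(cocycleP w) // (plug0 tcomp_graded).
rewrite (plug_zero_r tcomp_graded _ _ _ [::]) (plug_zero_r tcomp_graded _ _ _ [:: _]) /= prednK //.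
by modulo_signs.
Qed.

Theorem operad_gerstenhaber : exists mulH : forall m n, cohomology d m -> cohomology d n ->
    cohomology d (m + n),
  exists brH : forall m n, cohomology d m -> cohomology d n -> cohomology d (m + n).-1,
    [/\ induced_by (d := d) (fun m n => @operad_dot K O comp mu m n) mulH,
        induced_by (d := d) (fun m n => @operad_bracket K O comp m n) brH
      & is_gerstenhaber_algebra mulH brH].
Proof.
exists (fun m n => mulH (m := m) (n := n)), (fun m n => brH (m := m) (n := n)); split.
- exact: (induced_opP dot_bilinear_op dot_cocycle dot_boundary_l dot_boundary_r).
- exact: (induced_opP br_bilinear_op br_cocycle br_boundary_l br_boundary_r).
split.
- split; last exact: mulH_assoc.
  exact: (induced_op_bilinear dot_bilinear_op dot_cocycle dot_boundary_l dot_boundary_r).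
- exact: mulH_comm.
- exact: (induced_op_bilinear br_bilinear_op br_cocycle br_boundary_l br_boundary_r).
- exact: brH_antisym.
- exact: brH_jacobi.
- exact: brH_leibniz.
Qed.

End TotalOperad.

(** * The operad of cochains *)

(* [None] stands for the sum [[1] + .. + [n]], the value of [Ri] away from the
   inputs of the inserted cochain. *)
Definition inner i n (q : option nat) : option nat :=
  if q is Some r then
    if (i <= r <= i + n - 1)%N then Some (r - (i - 1))%N else None
  else None.
Definition outer i n (q : option nat) : option nat := omap (R0 i n) q.

Ltac split_ranges := rewrite /inner /outer /=; unfold R0;
  repeat (match goal with |- context [if ?c then _ else _] =>
    lazymatch c with context [if _ then _ else _] => fail | _ => case: (boolP c) => ? end end;
    rewrite /=; try (exfalso; lia)); try (congr Some; lia).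

Section IndexMaps.
Variables (i j n p : nat).

(** The three sequential relations compare the indices read by f, g and h on both sides of that
    axiom; the three parallel ones do the same in the order f, g, h. *)
Lemma outer_seq q : (0 < i)%N -> (1 <= j <= n)%N -> (0 < p)%N ->
  outer i n (outer (i + j).-1 p q) = outer i (n + p).-1 q.
Proof. by move=> i0 jn p0; case: q => [r|//]; split_ranges. Qed.

Lemma inner_outer_seq q : (0 < i)%N -> (1 <= j <= n)%N -> (0 < p)%N ->
  inner i n (outer (i + j).-1 p q) = outer j p (inner i (n + p).-1 q).
Proof. by move=> i0 jn p0; case: q => [r|//]; split_ranges. Qed.

Lemma inner_seq q : (0 < i)%N -> (1 <= j <= n)%N -> (0 < p)%N ->
  inner (i + j).-1 p q = inner j p (inner i (n + p).-1 q).
Proof. by move=> i0 jn p0; case: q => [r|//]; split_ranges. Qed.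

Lemma outer_par q : (0 < i < j)%N -> (0 < n)%N -> (0 < p)%N ->
  outer i n (outer (j + n).-1 p q) = outer j p (outer i n q).
Proof. by move=> i0 jn p0; case: q => [r|//]; split_ranges. Qed.

Lemma inner_par_l q : (0 < i < j)%N -> (0 < n)%N -> (0 < p)%N ->
  inner i n (outer (j + n).-1 p q) = inner i n q.
Proof. by move=> i0 jn p0; case: q => [r|//]; split_ranges. Qed.

Lemma inner_par_r q : (0 < i < j)%N -> (0 < n)%N -> (0 < p)%N ->
  inner (j + n).-1 p q = inner j p (outer i n q).
Proof. by move=> i0 jn p0; case: q => [r|//]; split_ranges. Qed.

End IndexMaps.

Section CochainOperad.
Variables (K : fieldType) (A : lmodType K) (alpha : {linear A -> A}).

Local Notation coch := (cochain alpha).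

Lemma cochain_lin n (f : coch n) a : linear (f^~ a).
Proof. exact: cochain_linear (cochainP f) a. Qed.

Lemma cochain_sum n (f : coch n) a I (r : seq I) (P : pred I) (F : I -> 'rV[K]_n) :
  f (\sum_(i <- r | P i) F i) a = \sum_(i <- r | P i) f (F i) a.
Proof.
have f0 : f 0 a = 0.
  by have := cochain_lin f a (-1) 0 0; rewrite scaler0 addr0 scaleN1r addNr.
apply: (big_morph (fun v => f v a)) => // u v.
by have := cochain_lin f a 1 u v; rewrite !scale1r.
Qed.

Lemma cochain_scale n (f : coch n) a c v : f (c *: v) a = c *: f v a.
Proof.
have f0 : f 0 a = 0.
  by have := cochain_lin f a (-1) 0 0; rewrite scaler0 addr0 scaleN1r addNr.
by have := cochain_lin f a c v 0; rewrite f0 !addr0.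
Qed.

Lemma upd_sum n (f : coch n) v a j I (r : seq I) (F : I -> A) :
  f v (upd a j (\sum_(i <- r) F i)) = \sum_(i <- r) f v (upd a j (F i)).
Proof.
have lin := cochain_multilinear (cochainP f) v a j.
have f0 : f v (upd a j 0) = 0.
  by have := lin (-1) 0 0; rewrite scaler0 addr0 scaleN1r addNr.
apply: (big_morph (fun x => f v (upd a j x))) => // x y.
by have := lin 1 x y; rewrite !scale1r.
Qed.

Definition gen n (q : option nat) : 'rV[K]_n :=
  if q is Some r then cgen K n r else \sum_(1 <= t < n.+1) cgen K n t.

(** Arguments are sequences indexed by natural numbers from 1, so nested compositions involve
    arithmetic on indices but no casts of ordinals. *)
Definition eval_at n (f : coch n) (q : option nat) (s : nat -> A) : A :=
  f (gen n q) [ffun l : 'I_n => s l.+1].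

Definition in_range n (q : option nat) : bool :=
  if q is Some r then (1 <= r <= n)%N else true.

Definition args i n (t : A) (s : nat -> A) (k : nat) : A :=
  if (k < i)%N then iter n.-1 alpha (s k)
  else if k == i then t else iter n.-1 alpha (s (k + n - 1)%N).

Lemma eval_at_ext n (f : coch n) q s s' : (forall k, (1 <= k <= n)%N -> s k = s' k) ->
  eval_at f q s = eval_at f q s'.
Proof.
move=> e; congr (f _ _); apply/ffunP => l; rewrite !ffunE; apply: e.
by have := ltn_ord l; lia.
Qed.

Lemma eval_at_none n (f : coch n) s : eval_at f None s = \sum_(1 <= t < n.+1) eval_at f (Some t) s.
Proof. exact: cochain_sum. Qed.

Lemma iter_alpha_sum k I (r : seq I) (F : I -> A) :
  iter k alpha (\sum_(i <- r) F i) = \sum_(i <- r) iter k alpha (F i).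
Proof. by elim: k => //= k ->; rewrite linear_sum. Qed.

Lemma eval_at_alpha n (f : coch n) q s k : in_range n q ->
  iter k alpha (eval_at f q s) = eval_at f q (fun l => iter k alpha (s l)).
Proof.
have some r : (1 <= r <= n)%N ->
    iter k alpha (eval_at f (Some r) s) = eval_at f (Some r) (fun l => iter k alpha (s l)).
  move=> rn; elim: k => //= k ->; rewrite /eval_at (cochain_alpha (cochainP f)) //.
  by congr (f _ _); apply/ffunP => l; rewrite !ffunE.
case: q => [r|_]; first exact: some.
by rewrite !eval_at_none iter_alpha_sum !big_nat; apply: eq_bigr => r rn; apply: some; lia.
Qed.

Lemma entry_ffun n (s : nat -> A) k : (1 <= k <= n)%N ->
  entry [ffun l : 'I_n => s l.+1] k = s k.
Proof.
move=> kn; have kn' : (k.-1 < n)%N by lia.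
by rewrite /entry (insubT (fun i => i < n)%N kn') /= ffunE /= prednK //; lia.
Qed.

Lemma gen_none n (r : 'I_n) : gen n None 0 r = 1.
Proof.
rewrite /gen summxE (bigD1_seq r.+1) ?iota_uniq //=; last first.
  by rewrite mem_index_iota; have := ltn_ord r; lia.
rewrite mxE eqxx big1 ?addr0 // => t tr.
by rewrite mxE eq_sym (negPf tr).
Qed.

Lemma eval_at_comp_term m n i (f : coch m) (g : coch n) r s :
  (1 <= i <= m)%N -> (0 < n)%N -> (1 <= r <= (m + n).-1)%N ->
  f (cgen K m (R0 i n r))
    [ffun k : 'I_m => comp_arg i g r [ffun l : 'I_(m + n).-1 => s l.+1] k.+1]
  = eval_at f (Some (R0 i n r))
      (args i n (eval_at g (inner i n (Some r)) (fun l => s (i + l).-1)) s).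
Proof.
move=> im n0 rn; congr (f _ _); apply/ffunP => k; rewrite !ffunE /comp_arg /args.
have km := ltn_ord k.
case: ifP => ki; first by rewrite entry_ffun //; lia.
case: ifP => [/eqP ki'|ki']; last by rewrite entry_ffun //; lia.
rewrite /eval_at; congr (g _ _); first by rewrite /Ri /inner /gen; case: ifP.
apply/ffunP => l; rewrite !ffunE entry_ffun ?addnS //.
by have := ltn_ord l; lia.
Qed.

Lemma args_upd i m n t s (im : (i.-1 < m)%N) : (0 < i)%N ->
  [ffun k : 'I_m => args i n t s k.+1] =
  upd [ffun k : 'I_m => args i n 0 s k.+1] (Ordinal im) t.
Proof.
move=> i0; apply/ffunP => k; rewrite !ffunE /args -val_eqE /=.
have -> : (k == i.-1 :> nat) = (k.+1 == i) by lia.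
by case: eqP => [<-|//]; rewrite ltnn.
Qed.

(** The case [None] sums over all [r]. Outside the block i, .., i + n - 1, [R0] meets every [k]
    other than [i] once and [Ri] is the full sum. On the block [R0] is constantly [i] while [Ri]
    runs through [1], .., [n]; linearity in the i-th argument gathers these values into g at the
    full sum. *)
Lemma eval_at_comp m n i (f : coch m) (g : coch n) q s :
  (1 <= i <= m)%N -> (0 < n)%N -> in_range (m + n).-1 q ->
  eval_at (cochain_comp alpha m n i f g) q s =
  eval_at f (outer i n q) (args i n (eval_at g (inner i n q) (fun l => s (i + l).-1)) s).
Proof.
move=> im n0 qr; rewrite {1}/eval_at cochain_compE im n0 /= /comp_fun.
case: q qr => [r|_] /=.
  move=> rn; have rn' : (r.-1 < (m + n).-1)%N by lia.
  rewrite (bigD1 (Ordinal rn')) //= big1 ?addr0 => [|r' ne]; last first.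
    rewrite mxE; have -> : (r'.+1 == r) = false; last by rewrite scale0r.
    by apply: contraNF ne => /eqP e; rewrite -val_eqE /= -e.
  rewrite mxE /= prednK; last by lia.
  by rewrite eqxx scale1r eval_at_comp_term.
transitivity (\sum_(1 <= r < m + n) eval_at f (Some (R0 i n r))
    (args i n (eval_at g (inner i n (Some r)) (fun l => s (i + l).-1)) s)).
  rewrite -[X in _ = \sum_(1 <= _ < X) _](@prednK (m + n)); last by lia.
  rewrite [RHS]big_add1 big_mkord; apply: eq_bigr => r _.
  have -> : (\sum_(1 <= t < (m + n).-1.+1) cgen K (m + n).-1 t) 0 r = 1.
    exact: gen_none.
  by rewrite scale1r eval_at_comp_term //; have := ltn_ord r; lia.
set a := fun l => s (i + l).-1.
rewrite [RHS]eval_at_none.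
rewrite (@big_cat_nat _ _ _ i) //=; [|lia|lia].
rewrite [X in _ + X = _](@big_cat_nat _ _ _ (i + n)) //=; [|lia|lia].
rewrite [RHS](@big_cat_nat _ _ _ i) //=; [|lia|lia].
rewrite [X in _ = _ + X](@big_cat_nat _ _ _ i.+1) //=; [|lia].
congr (_ + (_ + _)).
- apply: eq_big_nat => r ri; rewrite /R0 /inner.
  have -> : (r <= i - 1)%N by lia.
  by have -> : (i <= r <= i + n - 1)%N = false by lia.
- have im' : (i.-1 < m)%N by lia.
  rewrite big_nat1 /eval_at (args_upd _ _ _ im'); last by lia.
  rewrite -/(eval_at g None a) eval_at_none upd_sum.
  have -> : \sum_(i <= r < i + n) f (gen m (Some (R0 i n r)))
        [ffun l : 'I_m =>
          args i n (g (gen n (inner i n (Some r))) [ffun l0 : 'I_n => a l0.+1]) s l.+1]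
    = \sum_(i <= r < i + n) eval_at f (Some i) (args i n (eval_at g (Some (r - (i - 1))%N) a) s).
    apply: eq_big_nat => r ri; rewrite /R0 /inner.
    have -> : (r <= i - 1)%N = false by lia.
    have -> : (r <= i + n - 1)%N by lia.
    by have -> : (i <= r)%N by lia.
  rewrite -{1}[i]add0n big_addn addKn big_add1 /=.
  apply: eq_big_nat => r rn; rewrite /eval_at (args_upd _ _ _ im'); last by lia.
  by have -> : (r + i - (i - 1) = r.+1)%N by lia.
- have -> : (m + n = m.+1 + (n - 1))%N by lia.
  have -> : (i + n = i.+1 + (n - 1))%N by lia.
  rewrite big_addn addnK; apply: eq_big_nat => r rm; rewrite /R0 /inner.
  have -> : (r + (n - 1) <= i - 1)%N = false by lia.
  have -> : (r + (n - 1) <= i + n - 1)%N = false by lia.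
  have -> : (i <= r + (n - 1) <= i.+1 + (n - 1) - 1)%N = false by lia.
  by have -> : (r + (n - 1) - n + 1 = r)%N by lia.
Qed.

Lemma inner_range i n q : (0 < i)%N -> (0 < n)%N -> in_range n (inner i n q).
Proof. by move=> i0 n0; case: q => //= r; case: ifP => //= h; lia. Qed.
Lemma outer_range m i n q : (1 <= i <= m)%N -> (0 < n)%N ->
  in_range (m + n).-1 q -> in_range m (outer i n q).
Proof. by move=> im n0; case: q => //= r rn; apply: R0_range. Qed.

Lemma cochain_expand n (f : coch n) v a :
  f v a = \sum_(r < n) v 0 r *: eval_at f (Some r.+1) (entry a).
Proof.
have {1}-> : v = \sum_(r < n) v 0 r *: cgen K n r.+1.
  apply/rowP => j; rewrite summxE (bigD1 j) //= big1 ?addr0 => [|r rj].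
    by rewrite !mxE eqxx mulr1.
  by rewrite !mxE eqSS eq_sym val_eqE (negPf rj) mulr0.
rewrite cochain_sum; apply: eq_bigr => r _; rewrite cochain_scale; congr (_ *: f _ _).
by apply/ffunP => l; rewrite ffunE /entry /= valK.
Qed.

Lemma cochain_part_eq m n (x : coch m) (y : coch n) : m = n ->
  (forall r s, (1 <= r <= m)%N -> eval_at x (Some r) s = eval_at y (Some r) s) ->
  forall k, part k x = part k y.
Proof.
move=> e; move: y; case: _ / e => y xy k; congr (part k _).
apply: cochain_ext => v a; rewrite !cochain_expand; apply: eq_bigr => r _.
by rewrite xy //; have := ltn_ord r; lia.
Qed.

Lemma cochain0 (f : coch 0) : f = 0.
Proof.
by apply: cochain_ext => v a; rewrite cochain_expand big_ord0.
Qed.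

Ltac range := first [ by rewrite /=; lia | by apply: inner_range; lia
  | by apply: outer_range; rewrite /=; lia ].

Lemma eval_at_eq n (f : coch n) q q' s s' : q = q' ->
  (forall k, (1 <= k <= n)%N -> s k = s' k) -> eval_at f q s = eval_at f q' s'.
Proof. by move=> ->; apply: eval_at_ext. Qed.

Lemma args_lt i n t s k : (k < i)%N -> args i n t s k = iter n.-1 alpha (s k).
Proof. by rewrite /args => ->. Qed.
Lemma args_eq i n t s k : k = i -> args i n t s k = t.
Proof. by rewrite /args => ->; rewrite ltnn eqxx. Qed.
Lemma args_gt i n t s k : (i < k)%N -> args i n t s k = iter n.-1 alpha (s (k + n - 1)%N).
Proof.
rewrite /args => ik; have -> : (k < i)%N = false by lia.
by have -> : (k == i) = false by lia.
Qed.

Lemma iter_alpha_add k l s : iter k alpha (iter l alpha s) = iter (k + l) alpha s.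
Proof. by rewrite iterD. Qed.

Lemma cochain_operad : is_operad (cochain_comp alpha) (cochain_id alpha).
Proof.
split.
- by move=> m n i _ _; apply: cochain_comp_bilinear.
- move=> m n p i j f g h im jn p0.
  apply: cochain_part_eq; first by lia.
  move=> r s rr.
  rewrite (@eval_at_comp (m + n).-1 p); [|range|range|range].
  rewrite (@eval_at_comp m n); [|range|range|range].
  rewrite (@eval_at_comp m (n + p).-1); [|range|range|range].
  rewrite (@eval_at_comp n p); [|range|range|range].
  apply: eval_at_eq => [|k km]; first by apply: outer_seq; lia.
  have [ki|ik|ki] := ltngtP k i.
  + rewrite !args_lt //; last by lia.
    by rewrite iter_alpha_add; congr (iter _ _ _); lia.
  + rewrite !args_gt //; last by lia.
    rewrite iter_alpha_add; congr (iter _ _ (s _)); lia.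
  rewrite !args_eq //; apply: eval_at_eq => [|l ln]; first by apply: inner_outer_seq; lia.
  have [lj|jl|lj] := ltngtP l j.
  + by rewrite !args_lt //; lia.
  + rewrite !args_gt //; last by lia.
    by congr (iter _ _ (s _)); lia.
  rewrite !args_eq //; last by lia.
  apply: eval_at_eq => [|t tp]; first by apply: inner_seq; lia.
  by congr s; lia.
- move=> m n p i j f g h i0 ij jm n0 p0.
  apply: cochain_part_eq; first by lia.
  move=> r s rr.
  rewrite (@eval_at_comp (m + n).-1 p); [|range|range|range].
  rewrite (@eval_at_comp m n); [|range|range|range].
  rewrite (@eval_at_comp (m + p).-1 n); [|range|range|range].
  rewrite (@eval_at_comp m p); [|range|range|range].
  apply: eval_at_eq => [|k km]; first by apply: outer_par; lia.
  have [ki|ik|ki] := ltngtP k i.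
  + rewrite !args_lt //; try lia.
    by rewrite !iter_alpha_add addnC.
  + have [kj|jk|kj] := ltngtP k j.
    * rewrite [LHS]args_gt // args_lt; last by lia.
      rewrite [RHS]args_lt // args_gt //.
      by rewrite !iter_alpha_add addnC.
    * rewrite !args_gt //; try lia.
      rewrite !iter_alpha_add addnC; congr (iter _ _ (s _)); lia.
    rewrite [LHS]args_gt // args_eq; last by lia.
    (* On one side alpha^(n-1) acts on the value of [h], on the other on its arguments:
       compatibility of cochains with alpha identifies them. The same happens for [g] and
       alpha^(p-1) below. *)
    rewrite [RHS]args_eq // eval_at_alpha; last by range.
    apply: eval_at_eq => [|t tp]; first by apply: inner_par_r; lia.
    by rewrite args_gt //; [congr (iter _ _ (s _)); lia|lia].
  rewrite [LHS]args_eq // [RHS]args_lt; last by lia.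
  rewrite args_eq // eval_at_alpha; last by range.
  apply: eval_at_eq => [|t tp]; first by apply: inner_par_l; lia.
  by rewrite args_lt //; lia.
- move=> m i f im.
  apply: cochain_part_eq; first by lia.
  move=> r s rr; rewrite eval_at_comp; [|range|range|range].
  apply: eval_at_eq => [|k km]; first by rewrite /= /R0; congr Some; repeat case: ifP; lia.
  have [ki|ik|ki] := ltngtP k i.
  + by rewrite args_lt.
  + by rewrite args_gt //=; congr s; lia.
  rewrite args_eq // /eval_at /= /id_fun ffunE.
  (* For n = 1 the full sum is also [1], so [Ri] is [1] in either case. *)
  have -> : gen 1 (inner i 1 (Some r)) 0 0 = 1.
    rewrite /=; case: ifP => h; last by rewrite /gen big_nat1 mxE.
    by rewrite mxE; have -> : (1 == r - (i - 1))%N by lia.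
  by rewrite scale1r /= addn1 /= ki.
- move=> m f m0.
  apply: cochain_part_eq; first by lia.
  move=> r s rr; rewrite eval_at_comp; [|range|range|range].
  rewrite {1}/eval_at /= /id_fun ffunE args_eq //.
  have -> : R0 1 m r = 1%N by rewrite /R0; repeat case: ifP; lia.
  rewrite mxE eqxx scale1r.
  apply: eval_at_eq => [|k km]; last by congr s; lia.
  rewrite /inner; case: ifP => h; last by lia.
  by congr Some; lia.
Qed.

End CochainOperad.

Section HomDendriformOperad.
Variables (K : fieldType) (A : lmodType K) (alpha : {linear A -> A}).
Variables (prec succ : {bilinear A -> A -> A}).
Hypothesis hA : is_hom_dendriform alpha prec succ.

Lemma eval_at_pi q s : in_range 2 q -> eval_at (dend_pi hA) q s =
  match q with
  | Some 1 => prec (s 1%N) (s 2%N)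
  | Some _ => succ (s 1%N) (s 2%N)
  | None => prec (s 1%N) (s 2%N) + succ (s 1%N) (s 2%N)
  end.
Proof.
rewrite /eval_at /= /pi_fun !ffunE /=.
case: q => [[|[|[|r]]]|] //= _; rewrite ?mxE /= ?scale0r ?scale1r ?addr0 ?add0r //.
have e (l : 'I_2) : (\sum_(1 <= t < 3) cgen K 2 t) 0 l = 1 := gen_none K l.
by rewrite !e !scale1r.
Qed.

(** At [1], [2] and [3] the equation is one hom-dendriform axiom each; the sum of both operations is
    the value of [pi] at [None]. *)
Lemma dend_pi_multiplication : is_multiplication (cochain_comp alpha) (dend_pi hA).
Proof.
suff h k : part k (cochain_comp alpha 2 2 1 (dend_pi hA) (dend_pi hA))
    = part k (cochain_comp alpha 2 2 2 (dend_pi hA) (dend_pi hA)).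
  by have := h 3%N; rewrite !part_id.
apply: cochain_part_eq => // -[|[|[|[|r]]]] s // _; rewrite !eval_at_comp // !eval_at_pi //=.
- exact: dend_prec_prec.
- exact: dend_succ_prec.
- exact: dend_succ_succ.
Qed.

End HomDendriformOperad.

Theorem mainTheorem1 (K : fieldType) (charK : [pchar K] =i pred0)
    (A : lmodType K) (alpha : {linear A -> A})
    (prec succ : {bilinear A -> A -> A})
    (hA : is_hom_dendriform alpha prec succ) :
  [/\ is_operad (cochain_comp alpha) (cochain_id alpha),
      is_multiplication (cochain_comp alpha) (dend_pi hA),
      is_associative_product (dend_dot hA)
        /\ is_differential (dend_diff hA),
      is_homotopy_G_algebra (operad_brace (cochain_comp alpha))
        (dend_dot hA) (dend_diff hA)
    & exists mulH : forall m n, dend_cohomology hA m -> dend_cohomology hA n ->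
                      dend_cohomology hA (m + n),
      exists brH : forall m n, dend_cohomology hA m -> dend_cohomology hA n ->
                      dend_cohomology hA (m + n).-1,
        [/\ induced_by (d := dend_complex hA) (dend_dot hA) mulH,
            induced_by (d := dend_complex hA) (dend_bracket alpha) brH
          & is_gerstenhaber_algebra mulH brH]].
Proof.
have op := cochain_operad alpha; have mu := dend_pi_multiplication hA.
split=> //; last 2 first.
- exact: (operad_homotopy_G op mu).
- exact: (operad_gerstenhaber op mu (d := dend_complex hA)
    (fun n x => erefl) (@cochain0 K A alpha)).
- split; first exact: (operad_dot_associative op mu).
  exact: (operad_diff_differential op mu).
Qed.
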